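(* Let $\alpha\in(0,2]$ and $H\in[1/2,1)$ with $\alpha H=3/2$, and let $W$, $G$, $\Delta^h_Bu(t,x)$ be as in the context. For $\rho\in(0,1)$ and $h>0$ set $$\delta=h^{\rho\alpha}\quad\text{and}\quad\varepsilon=\delta^{\frac{2H+2}{3+2\alpha}}=h^\rho.$$ Fix $0<t_1<t_2$. Then there exists $K>0$ such that for any $\rho\in(0,1)$ there exists $r_\rho\in(0,1)$ such that $$\|\Delta^h_Bu(t,x)\|_2^2\le K\rho\,h^2\log(1/h)$$ for all $t\in[t_1,t_2]$, $x\in\mathbb{R}$ and $h\in(0,r_\rho]$.
   Context: $\|Y\|_2=(\mathbb{E}|Y|^2)^{1/2}$. $G(t,x)$, $t>0$, $x\in\mathbb{R}$, is the fundamental solution of $\partial_t+(-\Delta)^{\alpha/2}$, i.e. $\int_{\mathbb{R}}e^{-i\xi x}G(t,x)\,dx=e^{-t|\xi|^\alpha}$. $\dot W$ is a centered generalized Gaussian noise on $\mathbb{R}\times\mathbb{R}$ with covariance $\mathbb{E}[\dot W(t,x)\dot W(s,y)]=|t-s|^{2H-2}\delta(x-y)$ ($\delta$ here the Dirac delta), i.e. Wiener integrals are centered jointly Gaussian with $\mathbb{E}\big[\iint f\,dW\iint g\,dW\big]=\int_{\mathbb{R}}\int_{\mathbb{R}}|r-r'|^{2H-2}\int_{\mathbb{R}}f(r,z)g(r',z)\,dz\,dr\,dr'$ (the assumptions on $\alpha,H$ force $H\ge3/4$). The mild solution of $\partial_tu=-(-\Delta)^{\alpha/2}u+\dot W$,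 $u(0,\cdot)=0$, is $u(t,x)=\int_0^t\int_{\mathbb{R}}G(t-s,x-y)\,W(ds\,dy)$. For a Borel set $C\subset[0,t]\times\mathbb{R}$, $$\Delta^h_Cu(t,x):=\iint_C[G(t-s,x+h-y)-G(t-s,x-y)]\,W(ds\,dy),$$ where the terms $G(t-s,\cdot)$ are restricted to $0\le s\le t$. Given $t,x$, $\delta\in(0,t)$ and $\varepsilon>0$, put $A=[t-\delta,t]\times[x-\varepsilon,x+\varepsilon]$ and $B=([0,t]\times\mathbb{R})\setminus A$; thus $\Delta^h_Bu(t,x)=u(t,x+h)-u(t,x)-\Delta^h_Au(t,x)$. *)

(* Defs.v *)
From HB Require Import structures.
From mathcomp Require Export all_boot all_order all_algebra.
From mathcomp Require Export all_classical all_reals all_analysis.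

Set Implicit Arguments.
Unset Strict Implicit.
Unset Printing Implicit Defensive.

Export Order.TTheory GRing.Theory Num.Theory.
Export numFieldNormedType.Exports.

#[global] Open Scope classical_set_scope.
#[global] Open Scope ring_scope.

(* The Fourier transform of [G t] is split into its real part (cosine) and its
   imaginary part (sine).  It determines [G t] up to a null set; continuity on
   t > 0 selects the usual pointwise defined version.  Nothing is said about
   [G t] for t <= 0. *)
Definition is_fundamental_solution (R : realType) (alpha : R) (G : R -> R -> R)
    : Prop :=
  (forall t x : R, 0 < t -> {for (t, x), continuous (fun p : R * R => G p.1 p.2)})
  /\ forall t : R, 0 < t ->
     [/\ (@lebesgue_measure R).-integrable setT (fun x => (G t x)%:E),
         forall xi : R,
           \int[@lebesgue_measure R]_x (cos (xi * x) * G t x)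
             = expR (- (t * `|xi| `^ alpha)) &
         forall xi : R,
           \int[@lebesgue_measure R]_x (sin (xi * x) * G t x) = 0].

(* The iterated integral, over r and r' in R, of |r - r'|^(2H-2) times the
   integral of f(r,z) g(r',z) in z.  Since [0 `^ a = 0] for a != 0, the kernel
   vanishes on the (null) diagonal r = r'. *)
Definition noise_cov (R : realType) (H : R) (f g : R * R -> R) : \bar R :=
  (\int[@lebesgue_measure R]_r \int[@lebesgue_measure R]_r'
     ((`|r - r'| `^ (2 * H - 2))%:E *
      \int[@lebesgue_measure R]_z (f (r, z) * g (r', z))%:E))%E.

(* Deterministic integrands for which the covariance integral of |f| against
   itself, hence that of any two of them, converges absolutely. *)
Definition noise_integrand (R : realType) (H : R) (f : R * R -> R) : Prop :=
  measurable_fun [set: R * R] f /\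
  (noise_cov H (fun p => `|f p|%R) (fun p => `|f p|%R) < +oo)%E.

(* A centered Gaussian law may be degenerate; the case s = 0 is separate because
   [normal_prob m 0] is not the Dirac mass at m. *)
Definition centered_gaussian d (Omega : measurableType d) (R : realType)
    (P : probability Omega R) (X : Omega -> R) : Prop :=
  exists2 s : R, 0 <= s &
    forall A : set R, measurable A ->
      P (X @^-1` A) = if s == 0 then \d_(0 : R) A else normal_prob 0 s A.

(* [W f] is the Wiener integral of f against the noise.  It is a total function
   of f, but carries meaning only on integrands.  Joint Gaussianity: every
   finite linear combination is Gaussian. *)
Definition is_fractional_noise d (Omega : measurableType d) (R : realType)
    (P : probability Omega R) (H : R) (W : (R * R -> R) -> {RV P >-> R})
    : Prop :=
  (forall (n : nat) (f : 'I_n -> R * R -> R) (c : 'I_n -> R),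
     (forall i, noise_integrand H (f i)) ->
     centered_gaussian P (fun w => \sum_(i < n) c i * W (f i) w))
  /\ forall f g : R * R -> R, noise_integrand H f -> noise_integrand H g ->
     ('E_P[fun w => (W f w * W g w)%R] = noise_cov H f g)%E.

(* The kernel of Delta^h_C u(t,x), extended by 0 outside C.  Times s >= t are cut
   off: s = t is a null line, on which G(0, .) is not a function. *)
Definition increment_kernel (R : realType) (G : R -> R -> R) (C : set (R * R))
    (t x h : R) : R * R -> R :=
  fun p => \1_(C `&` [set q : R * R | 0 <= q.1 < t]) p *
           (G (t - p.1) (x + h - p.2) - G (t - p.1) (x - p.2)).

Definition increment d (Omega : measurableType d) (R : realType)
    (P : probability Omega R) (W : (R * R -> R) -> {RV P >-> R})
    (G : R -> R -> R) (C : set (R * R)) (t x h : R) : {RV P >-> R} :=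
  W (increment_kernel G C t x h).

Definition near_set (R : realType) (t x delta eps : R) : set (R * R) :=
  `[t - delta, t] `*` `[x - eps, x + eps].

Definition far_set (R : realType) (t x delta eps : R) : set (R * R) :=
  (`[0, t] `*` [set: R]) `\` near_set t x delta eps.

Definition window_time (R : realType) (alpha rho h : R) : R :=
  h `^ (rho * alpha).

Definition window_space (R : realType) (alpha H rho h : R) : R :=
  window_time alpha rho h `^ ((2 * H + 2) / (3 + 2 * alpha)).

Lemma window_spaceE (R : realType) (alpha H rho h : R) :
  0 < alpha -> alpha * H = 3 / 2 ->
  window_space alpha H rho h = h `^ rho.
Proof.
move=> a0 aH.
have d0 : 3 + 2 * alpha != 0 by rewrite gt_eqF// addr_gt0// mulr_gt0.
rewrite /window_space /window_time -powRrM; congr (_ `^ _).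
rewrite -mulrA -[RHS]mulr1; congr (_ * _).
rewrite mulrA mulrDr mulrCA aH (mulrC 2) divfK ?pnatr_eq0//.
by rewrite (mulrC alpha) divff.
Qed.

(* Main.v *)
From HB Require Import structures.
Require Import Defs.
From mathcomp Require Import ring lra measurable_realfun.

Set Implicit Arguments.
Unset Strict Implicit.
Unset Printing Implicit Defensive.

(** Write p = 1 / alpha, so that H = 3p / 2, and s = t - r for the time elapsed
    between a noise point (r, z) and the observation time t; the natural length
    scale at time s is q = s ^ p, and delta ^ p = eps is the half-width of the
    removed window. The kernel f of the far increment is the restriction of
    G(s, y + h) - G(s, y), y = x - z, to s > delta or |y| > eps.

    By the isometry of the Wiener integral the left-hand side is the covariance
    of f with itself, which only increases when f is replaced by |f|: no
    cancellation is used. The proof is then a count of powers of s.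

    Fourier inversion (cosine_inversion, through the Poisson kernel) gives
    pi G(s, y) = int_0^oo cos(y xi) exp(- s xi^alpha) dxi. Differencing in y, and
    integrating once by parts in xi, yields
        |G(s, y + h) - G(s, y)| <= C h min(q^-2, q^-1 / |y|)
    (fundamental_solution_increment). Hence the square of f is at most a multiple
    of h^2 q^-2 / (w^2 + y^2), with w = q in general, and with w = eps when
    s <= delta because then |y| > eps on the support of f (far_kernel_sq). This
    is a multiple of a Poisson kernel in y, so its integral over space is
    explicit, and the Cauchy-Schwarz inequality gives
        int |f(r, z) f(r', z)| dz <= C h^2 (s^-p w^(-1/2)) s'^(-H)
    (far_space_integral); for the time s' the general bound w = q is enough.

    It remains to integrate in time. The integral in s' of
    |s - s'|^(2H - 2) s'^(-H) is a multiple of s^(H - 1) by homogeneity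
    (inner_time_integral). Multiplied by s^-p w^(-1/2) this is 1 / s for
    s > delta, by the relation H = 3p / 2, and delta^(-p/2) s^(p/2 - 1) for
    s <= delta. The second part has an integral independent of delta, and the
    first one contributes ln (t / delta) = ln t + rho alpha ln (1 / h)
    (outer_time_integral, noise_cov_far_le). For h small in terms of rho all the
    constants are dominated by rho ln (1 / h), which is the claim. *)

(** * Integration on the line *)

(** The integral of a nonnegative function is a supremum over the simple functions
    below it, and dropping the negative part of u only increases its integral.
    This serves for iterated integrals, whose inner integrals are compared
    pointwise before anything is known of their measurability. *)
Lemma le_integral_of_ge0 d (T : measurableType d) (R : realType)
    (mu : {measure set T -> \bar R}) (D : set T) (u v : T -> \bar R) :
  (forall x, D x -> (u x <= v x)%E) -> (forall x, D x -> (0 <= v x)%E) ->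
  (\int[mu]_(x in D) u x <= \int[mu]_(x in D) v x)%E.
Proof.
move=> uv v0; rewrite !(integral_mkcond D).
set u1 := u \_ D; set v1 := v \_ D.
have v10 x : (0 <= v1 x)%E by apply: erestrict_ge0.
have uv1 x : (u1 x <= v1 x)%E by apply: lee_restrict.
apply: (@le_trans _ _ (\int[mu]_x (u1^\+ x))%E).
  rewrite integralE -[leRHS]adde0 leeD2l// leeNl oppe0.
  by apply: integral_ge0 => x _.
have up0 x : (0 <= u1^\+ x)%E by [].
rewrite (ge0_integralTE mu up0) (ge0_integralTE mu v10).
apply: ereal_sup_le => _ /= [h hu <-]; exists h => // x.
by rewrite (le_trans (hu x))// funeposE ge_max uv1 v10.
Qed.

Section reflection.
Context {R : realType}.
Local Notation mu := (@lebesgue_measure R).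

Definition reflection (c : R) : measurableTypeR R -> measurableTypeR R :=
  fun x => (c - x)%R.

Lemma measurable_reflection (c : R) :
  measurable_fun [set: measurableTypeR R] (reflection c).
Proof. exact: measurable_funB. Qed.

HB.instance Definition _ (c : R) :=
  isMeasurableFun.Build _ _ _ _ _ (measurable_reflection c).

Lemma lebesgue_measure_reflection (c : R) (A : set R) : measurable A ->
  pushforward mu (reflection c) A = mu A.
Proof.
move=> mA.
apply: esym.
apply: (lebesgue_measure_unique (mu := pushforward mu (reflection c)))
  => //= _ [[a b]] _ <-.
rewrite /pushforward.
rewrite (_ : _ @^-1` _ = `[c - b, c - a[%classic); last first.
  apply/seteqP; split => x /=; rewrite /reflection !in_itv/= => /andP[? ?];
    apply/andP; split; lra.
rewrite !lebesgue_measure_itv/= !lte_fin.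
rewrite ltrD2l ltrN2; case: ifPn => // _.
by rewrite -!EFinB; congr EFin; ring.
Qed.

Lemma ge0_integral_reflection (c : R) (g : R -> \bar R) :
  measurable_fun setT g -> (forall x : R, (0 <= g x)%E) ->
  (\int[mu]_x g (c - x)%R = \int[mu]_x g x)%E.
Proof.
move=> mg g0.
transitivity (\int[pushforward mu (reflection c)]_x g x)%E.
  by rewrite ge0_integral_pushforward//=; exact: measurable_reflection.
by apply: eq_measure_integral => A mA _; exact: lebesgue_measure_reflection.
Qed.

Lemma ge0_integral_shift (c : R) (g : R -> \bar R) :
  measurable_fun setT g -> (forall x : R, (0 <= g x)%E) ->
  (\int[mu]_x g (x - c)%R = \int[mu]_x g x)%E.
Proof.
move=> mg g0; rewrite -[RHS](ge0_integral_reflection 0)//.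
rewrite -[RHS](ge0_integral_reflection c)//.
- by apply: eq_integral => x _; congr g; ring.
- by apply: measurableT_comp => //; apply: measurable_funB.
Qed.

End reflection.

Section half_line.
Context {R : realType}.
Local Notation mu := (@lebesgue_measure R).
Implicit Types f F g G : R -> R.

Lemma within_continuous_half_line f :
  (forall x : R, 0 < x -> {for x, continuous f}) ->
  f x @[x --> 0^'+] --> f 0 -> {within `[0, +oo[, continuous f}.
Proof.
move=> cf f0; apply/continuous_within_itvcyP; split => //.
by move=> x; rewrite in_itv/= andbT; exact: cf.
Qed.

Lemma powR_continuous_half_line (a : R) : 0 < a ->
  {within `[0, +oo[, continuous (fun x : R => x `^ a)}.
Proof.
move=> a0; apply: within_continuous_half_line => [x x0|].
  apply: differentiable_continuous; apply/derivable1_diffP.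
  by apply: derivable_powR; rewrite in_itv/= andbT.
by rewrite powR0 ?gt_eqF//; exact: powR_cvg0.
Qed.

Lemma measurable_half_line f :
  {within `[0, +oo[, continuous f} -> measurable_fun (`[0, +oo[%classic : set R) f.
Proof. by move=> cf; apply: subspace_continuous_measurable_fun. Qed.

Lemma within_cvg0 f : {within `[0, +oo[, continuous f} ->
  f x @[x --> 0^'+] --> f 0.
Proof. by move=> /continuous_within_itvcyP[]. Qed.

Lemma ge0_FTC2y f F (l : R) :
  (forall x : R, 0 <= x -> 0 <= f x) ->
  {within `[0, +oo[, continuous f} -> {within `[0, +oo[, continuous F} ->
  (forall x : R, 0 < x -> is_derive x 1 F (f x)) ->
  F x @[x --> +oo] --> l ->
  (\int[mu]_(x in `[0%R, +oo[) (f x)%:E = (l - F 0)%:E)%E /\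
  mu.-integrable (`[0, +oo[%classic : set R) (EFin \o f).
Proof.
move=> f0 cf cF dF Fl.
have fE : (\int[mu]_(x in `[0%R, +oo[) (f x)%:E = (l - F 0)%:E)%E.
  rewrite EFinB; apply: ge0_continuous_FTC2y => //.
  - by move=> x x0; apply: (@ex_derive _ _ _ _ _ _ _ (dF x x0)).
  - exact: within_cvg0.
  - move=> x; rewrite in_itv/= andbT => x0.
    by rewrite derive1E; apply: (@derive_val _ _ _ _ _ _ _ (dF x x0)).
split => //; apply/integrableP; split.
  by apply/measurable_EFinP; exact: measurable_half_line.
under eq_integral.
  move=> x; rewrite inE/= in_itv/= andbT => x0.
  rewrite ger0_norm ?f0//; over.
by rewrite fE ltry.
Qed.

(** A signed integrand is reduced to the nonnegative one f + g, whose primitive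
    is F + G. *)
Lemma dominated_FTC2y f F g G (l m : R) :
  (forall x : R, 0 <= x -> `|f x| <= g x) ->
  {within `[0, +oo[, continuous f} -> {within `[0, +oo[, continuous F} ->
  (forall x : R, 0 < x -> is_derive x 1 F (f x)) ->
  F x @[x --> +oo] --> l ->
  {within `[0, +oo[, continuous g} -> {within `[0, +oo[, continuous G} ->
  (forall x : R, 0 < x -> is_derive x 1 G (g x)) ->
  G x @[x --> +oo] --> m ->
  mu.-integrable (`[0, +oo[%classic : set R) (EFin \o f) /\
  \int[mu]_(x in `[0, +oo[) f x = l - F 0.
Proof.
move=> fg cf cF dF Fl cg cG dG Gm.
have [gE ig] : (\int[mu]_(x in `[0%R, +oo[) (g x)%:E = (m - G 0)%:E)%E /\
    mu.-integrable (`[0, +oo[%classic : set R) (EFin \o g).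
  apply: ge0_FTC2y => // x x0.
  by rewrite (le_trans _ (fg x x0)).
have if_ : mu.-integrable (`[0, +oo[%classic : set R) (EFin \o f).
  apply: le_integrable ig => //.
    by apply/measurable_EFinP; exact: measurable_half_line.
  move=> x /=; rewrite in_itv/= andbT => x0; rewrite lee_fin.
  by rewrite (le_trans (fg x x0))// ler_norm.
split => //.
have [fgE _] : (\int[mu]_(x in `[0%R, +oo[) (f x + g x)%:E =
     ((l + m) - (F 0 + G 0))%:E)%E /\
    mu.-integrable (`[0, +oo[%classic : set R) (EFin \o (fun x => f x + g x)).
  apply: (@ge0_FTC2y (fun x => f x + g x) (fun x => F x + G x)).
  - by move=> x x0; have := fg x x0; rewrite ler_norml => /andP[? _]; lra.
  - by move=> x; apply: cvgD; [exact: cf|exact: cg].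
  - by move=> x; apply: cvgD; [exact: cF|exact: cG].
  - by move=> x x0; have := dF x x0; have := dG x x0; move=> ? ?; apply: is_deriveD.
  - exact: cvgD.
have := @RintegralD _ _ _ mu _ f g (measurable_itv _) if_ ig.
rewrite {1 3}/Rintegral fgE gE/= => h.
by apply: (@addIr _ (m - G 0)); rewrite -h; ring.
Qed.

End half_line.

(** * Exponential and Poisson integrals *)

Section elementary_integrals.
Context {R : realType}.
Local Notation mu := (@lebesgue_measure R).

Lemma is_derive1_mul (f g : R -> R) (x a b : R) :
  is_derive x 1 f a -> is_derive x 1 g b ->
  is_derive x 1 (fun y => f y * g y) (a * g x + f x * b).
Proof.
move=> df dg; apply: (is_derive_eq (is_deriveM df dg)).
by rewrite /GRing.scale/=; ring.
Qed.

Lemma is_derive1_mulr (c x : R) : is_derive x 1 (fun y => c * y) c.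
Proof. by apply: is_derive_eq; rewrite /GRing.scale/=; ring. Qed.

Lemma is_derive1_cmul (c : R) (f : R -> R) (x a : R) :
  is_derive x 1 f a -> is_derive x 1 (fun y => c * f y) (c * a).
Proof.
by move=> df; apply: is_derive_eq; rewrite /GRing.scale/=; ring.
Qed.

Lemma is_derive_continuous (f df : R -> R) :
  (forall x : R, is_derive x 1 f (df x)) -> continuous f.
Proof.
move=> h x; apply: differentiable_continuous; apply/derivable1_diffP.
by apply: (@ex_derive _ _ _ _ _ _ _ (h x)).
Qed.

Lemma cvg_expRN (a : R) : 0 < a -> expR (- (a * x)) @[x --> +oo] --> (0 : R).
Proof.
move=> a0; apply: (@cvg_comp _ _ _ (fun x => a * x) (fun x => expR (- x)) _ (+oo%R)).
  exact: gt0_cvgMry.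
exact: cvgr_expR.
Qed.

(** Used for the boundary terms at infinity of oscillating primitives. *)
Lemma cvg_expRN_bounded (a M : R) (b : R -> R) : 0 < a ->
  (forall x : R, `|b x| <= M) -> expR (- (a * x)) * b x @[x --> +oo] --> (0 : R).
Proof.
move=> a0 bM; apply: norm_cvg0.
apply: (@squeeze_cvgr _ _ _ _ (cst 0) (fun x => M * expR (- (a * x)))).
- near=> x; rewrite normr_ge0/= normrM ger0_norm ?expR_ge0// mulrC.
  by rewrite ler_wpM2r ?expR_ge0.
- exact: cvg_cst.
- rewrite -[X in _ --> X](mulr0 M); apply: cvgM; first exact: cvg_cst.
  exact: cvg_expRN.
Unshelve. all: end_near. Qed.

Lemma is_derive_expRN (a x : R) :
  is_derive x 1 (fun x => expR (- (a * x))) (- (a * expR (- (a * x)))).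
Proof.
have h : is_derive x 1 (fun y : R => - (a * y)) (- a).
  by apply: is_derive_eq; rewrite /GRing.scale/=; ring.
apply: (is_derive_eq (is_derive1_comp (is_derive_expR _) h)).
by ring.
Qed.

Lemma is_derive1_sinM (u x : R) :
  is_derive x 1 (fun x => sin (u * x)) (u * cos (u * x)).
Proof.
apply: (is_derive_eq (is_derive1_comp (is_derive_sin _) (is_derive1_mulr u x))).
by ring.
Qed.

Lemma is_derive1_cosM (u x : R) :
  is_derive x 1 (fun x => cos (u * x)) (- (u * sin (u * x))).
Proof.
apply: (is_derive_eq (is_derive1_comp (is_derive_cos _) (is_derive1_mulr u x))).
by ring.
Qed.

Lemma norm_cos_le1 (x : R) : `|cos x| <= 1.
Proof. by rewrite ler_norml cos_le1 cos_geN1. Qed.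

Lemma norm_sin_le1 (x : R) : `|sin x| <= 1.
Proof. by rewrite ler_norml sin_le1 sin_geN1. Qed.

Lemma continuous_expRN (a : R) : continuous (fun x => expR (- (a * x))).
Proof. exact: is_derive_continuous (is_derive_expRN a). Qed.

Lemma continuous_cosM (u : R) : continuous (fun x => cos (u * x)).
Proof. exact: is_derive_continuous (is_derive1_cosM u). Qed.

Lemma continuous_sinM (u : R) : continuous (fun x => sin (u * x)).
Proof. exact: is_derive_continuous (is_derive1_sinM u). Qed.

Lemma is_derive_primitive_expRN (a x : R) : 0 < a ->
  is_derive x 1 (fun x => - a^-1 * expR (- (a * x))) (expR (- (a * x))).
Proof.
move=> a0; apply: (is_derive_eq (is_derive1_cmul (- a^-1) (is_derive_expRN a x))).
by field; rewrite gt_eqF.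
Qed.

Lemma integral_expRN (a : R) : 0 < a ->
  (\int[mu]_(x in `[0%R, +oo[) (expR (- (a * x)))%:E = (a^-1)%:E)%E /\
  mu.-integrable (`[0, +oo[%classic : set R)
    (EFin \o (fun x => expR (- (a * x)))).
Proof.
move=> a0.
have -> : a^-1 = 0 - (- a^-1 * expR (- (a * 0))) :> R.
  by rewrite mulr0 oppr0 expR0; ring.
apply: (@ge0_FTC2y _ _ (fun x => - a^-1 * expR (- (a * x)))).
- by move=> x _; exact: expR_ge0.
- by apply: continuous_subspaceT; exact: continuous_expRN.
- apply: continuous_subspaceT => x; apply: cvgM; first exact: cvg_cst.
  exact: continuous_expRN.
- by move=> x _; exact: is_derive_primitive_expRN.
- rewrite -[X in _ --> X](mulr0 (- a^-1)); apply: cvgM; first exact: cvg_cst.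
  exact: cvg_expRN.
Qed.

Lemma integral_cos_expRN (eta u : R) : 0 < eta ->
  mu.-integrable (`[0, +oo[%classic : set R)
    (EFin \o (fun x => expR (- (eta * x)) * cos (u * x))) /\
  \int[mu]_(x in `[0, +oo[) (expR (- (eta * x)) * cos (u * x)) =
    eta / (eta ^+ 2 + u ^+ 2).
Proof.
move=> eta0.
have D0 : 0 < eta ^+ 2 + u ^+ 2 by rewrite ltr_wpDr ?sqr_ge0 ?exprn_gt0.
pose b x := (eta ^+ 2 + u ^+ 2)^-1 * (u * sin (u * x) - eta * cos (u * x)).
pose F x := expR (- (eta * x)) * b x.
have db (x : R) : is_derive x 1 b
    ((u * (u * cos (u * x)) + eta * (u * sin (u * x))) / (eta ^+ 2 + u ^+ 2)).
  apply: (is_derive_eq (is_derive1_cmul (eta ^+ 2 + u ^+ 2)^-1 (is_deriveB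
     (is_derive1_cmul u (is_derive1_sinM u x))
     (is_derive1_cmul eta (is_derive1_cosM u x))))).
  by ring.
have dF (x : R) : is_derive x 1 F (expR (- (eta * x)) * cos (u * x)).
  apply: (is_derive_eq (is_derive1_mul (is_derive_expRN eta x) (db x))).
  by rewrite /b; field; rewrite gt_eqF.
have -> : eta / (eta ^+ 2 + u ^+ 2) = 0 - F 0.
  by rewrite /F /b !mulr0 oppr0 expR0 sin0 cos0; ring.
apply: (@dominated_FTC2y _ _ F (fun x => expR (- (eta * x)))
    (fun x => - eta^-1 * expR (- (eta * x))) _ 0).
- move=> x _; rewrite normrM (ger0_norm (expR_ge0 _)).
  by rewrite ler_piMr ?expR_ge0// norm_cos_le1.
- apply: continuous_subspaceT => x; apply: cvgM; first exact: continuous_expRN.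
  exact: continuous_cosM.
- by apply: continuous_subspaceT; exact: is_derive_continuous dF.
- apply: (@cvg_expRN_bounded _ ((`|u| + eta) / (eta ^+ 2 + u ^+ 2))) => // x.
  rewrite /b normrM normfV (gtr0_norm D0) mulrC ler_pM2r ?invr_gt0//.
  rewrite (le_trans (ler_normB _ _))// !normrM (gtr0_norm eta0) lerD//.
    by rewrite ler_piMr// norm_sin_le1.
  by rewrite ler_piMr ?norm_cos_le1// ltW.
- by apply: continuous_subspaceT; exact: continuous_expRN.
- apply: continuous_subspaceT => x; apply: cvgM; first exact: cvg_cst.
  exact: continuous_expRN.
- by move=> x _; exact: is_derive_primitive_expRN.
- rewrite -[X in _ --> X](mulr0 (- eta^-1)); apply: cvgM; first exact: cvg_cst.
  exact: cvg_expRN.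
Qed.

(** The primitive is atan (y / w); the total mass pi is independent of w, which
    is what makes these kernels an approximate identity as w tends to 0. *)
Lemma integral_poisson_kernel (w : R) : 0 < w ->
  (\int[mu]_y ((w / (w ^+ 2 + y ^+ 2))%:E) = pi%:E)%E.
Proof.
move=> w0.
have D0 (y : R) : 0 < w ^+ 2 + y ^+ 2 by rewrite ltr_wpDr ?sqr_ge0 ?exprn_gt0.
have dF (x : R) : is_derive x 1 (fun y => atan (w^-1 * y)) (w / (w ^+ 2 + x ^+ 2)).
  apply: (is_derive_eq (is_derive1_comp (is_derive1_atan _) (is_derive1_mulr w^-1 x))).
  have E0 : 1 + (w^-1 * x) ^+ 2 = (w ^+ 2 + x ^+ 2) / w ^+ 2.
    by field; rewrite gt_eqF.
  by rewrite E0; field; rewrite !gt_eqF.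
have cp : continuous (fun y : R => w / (w ^+ 2 + y ^+ 2)).
  move=> x; apply: cvgM; first exact: cvg_cst.
  apply: cvgV; first by rewrite gt_eqF.
  apply: cvgD; [exact: cvg_cst | exact: exprn_continuous].
rewrite ge0_symfun_integralT//=; last 2 first.
- by move=> x; rewrite divr_ge0 ?ltW.
- by move=> x /=; rewrite sqrrN.
rewrite (_ : [set x | _] = `[0, +oo[%classic); last first.
  by apply/seteqP; split => x/=; rewrite in_itv/= andbT.
suff [-> _] : (\int[mu]_(x in `[0%R, +oo[) (w / (w ^+ 2 + x ^+ 2))%:E =
    (pi / 2 - atan (w^-1 * 0))%:E)%E /\
    mu.-integrable (`[0, +oo[%classic : set R)
      (EFin \o (fun x => w / (w ^+ 2 + x ^+ 2))).
  by rewrite mulr0 atan0 subr0 -EFinM; congr EFin; field.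
apply: (@ge0_FTC2y _ _ (fun y => atan (w^-1 * y))).
- by move=> x _; rewrite divr_ge0 ?ltW.
- by apply: continuous_subspaceT; exact: cp.
- by apply: continuous_subspaceT; exact: is_derive_continuous dF.
- apply: (@cvg_comp _ _ _ (fun x => w^-1 * x) atan _ (+oo%R)).
    by apply: gt0_cvgMry => //; rewrite invr_gt0.
  exact: cvgy_atan.
Qed.

End elementary_integrals.

(** * Power integrals *)

Lemma ge0_integral_bigcup_le d (T : measurableType d) (R : realType)
    (mu : {measure set T -> \bar R}) (F : (set T)^nat) (f : T -> \bar R)
    (M : \bar R) :
  nondecreasing_seq F -> (forall i, measurable (F i)) ->
  (forall i, measurable_fun (F i) f) -> (forall i x, F i x -> (0 <= f x)%E) ->
  (forall i, (\int[mu]_(x in F i) f x <= M)%E) ->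
  (\int[mu]_(x in \bigcup_i F i) f x <= M)%E.
Proof.
move=> nF mF mf f0 fM.
have := ge0_nondecreasing_set_cvg_integral (mu := mu) nF mF mf f0.
move=> h; rewrite -(cvg_lim _ h)//; apply: lime_le; first exact: (cvgP _ h).
by near=> n.
Unshelve. all: end_near. Qed.

Section power_integrals.
Context {R : realType}.
Local Notation mu := (@lebesgue_measure R).

Lemma FTC2_pos (f F : R -> R) (a c : R) : 0 < a -> a <= c ->
  (forall x : R, 0 < x -> is_derive x 1 F (f x)) ->
  (forall x : R, 0 < x -> {for x, continuous f}) ->
  (\int[mu]_(x in `[a, c]) (f x)%:E = (F c - F a)%:E)%E.
Proof.
move=> a0; rewrite le_eqVlt => /predU1P[<- _ _|ac dF cf].
  by rewrite set_itv1 integral_set1 subrr.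
have cF (x : R) : 0 < x -> {for x, continuous F}.
  move=> x0; apply: differentiable_continuous; apply/derivable1_diffP.
  by apply: (@ex_derive _ _ _ _ _ _ _ (dF x x0)).
rewrite EFinB; apply: continuous_FTC2 => //.
- apply: continuous_in_subspaceT => x; rewrite inE/= in_itv/= => /andP[ax _].
  by apply: cf; exact: lt_le_trans ax.
- split.
  + move=> x; rewrite in_itv/= => /andP[ax _].
    have x0 := lt_trans a0 ax.
    by apply: (@ex_derive _ _ _ _ _ _ _ (dF x x0)).
  + by apply: cvg_at_right_filter; exact: cF.
  + by apply: cvg_at_left_filter; apply: cF; exact: lt_trans ac.
- move=> x; rewrite in_itv/= => /andP[ax _].
  have x0 := lt_trans a0 ax.
  by rewrite derive1E; apply: (@derive_val _ _ _ _ _ _ _ (dF x x0)).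
Qed.

Lemma continuous_powR_pos (b x : R) : 0 < x -> {for x, continuous (fun u : R => u `^ b)}.
Proof.
move=> x0; apply: differentiable_continuous; apply/derivable1_diffP.
by apply: derivable_powR; rewrite in_itv/= andbT.
Qed.

Lemma measurable_powR_EFin (D : set R) (b : R) :
  measurable_fun D (fun u : R => (u `^ b)%:E).
Proof. by apply/measurable_EFinP; apply: measurable_funTS; exact: measurable_powR. Qed.

Lemma is_derive1_powRV (b x : R) : b != 0 -> 0 < x ->
  is_derive x 1 (fun u => b^-1 * u `^ b) (x `^ (b - 1)).
Proof.
move=> b0 x0.
by apply: (is_derive_eq (is_derive1_cmul b^-1 (is_derive1_powR b x0))); field.
Qed.

Lemma integral_powR_itv (b a c : R) : b != 0 -> 0 < a -> a <= c ->
  (\int[mu]_(x in `[a, c]) (x `^ (b - 1))%:E = (b^-1 * c `^ b - b^-1 * a `^ b)%:E)%E.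
Proof.
move=> b0 a0 ac.
exact: (FTC2_pos a0 ac (fun x x0 => is_derive1_powRV b0 x0)
  (fun x x0 => @continuous_powR_pos (b - 1) x x0)).
Qed.

(** The integrand may be unbounded at 0, hence the exhaustion of ]0, c] by the
    compact intervals [c / (n + 1), c]. *)
Lemma integral_powR0_le (b c : R) : 0 < b -> 0 < c ->
  (\int[mu]_(x in `]0%R, c]) (x `^ (b - 1))%:E <= (b^-1 * c `^ b)%:E)%E.
Proof.
move=> b0 c0.
have -> : `]0, c]%classic = \bigcup_n `[c / n.+1%:R, c]%classic.
  apply/seteqP; split => x /=; rewrite in_itv/=.
    move=> /andP[x0 xc]; have [n hn] := ltr_add_invr (divr_gt0 x0 c0).
    exists n => //=; rewrite in_itv/= xc andbT.
    by move: hn; rewrite add0r ltr_pdivlMr// mulrC => /ltW.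
  move=> [n _ /=]; rewrite in_itv/= => /andP[h ->]; rewrite andbT.
  by rewrite (lt_le_trans _ h)// divr_gt0.
apply: ge0_integral_bigcup_le => //.
- move=> m n mn; rewrite subsetEset => x /=; rewrite !in_itv/= => /andP[h ->].
  rewrite andbT (le_trans _ h)// ler_pM2l// lef_pV2 ?posrE//.
  by rewrite ler_nat ltnS.
- by move=> n; exact: measurable_powR_EFin.
- by move=> n x _; rewrite lee_fin powR_ge0.
move=> n; rewrite integral_powR_itv ?gt_eqF ?divr_gt0//; last first.
  by rewrite ler_pdivrMr// ler_peMr ?(ltW c0)// ler1n.
rewrite lee_fin gerBl mulr_ge0 ?powR_ge0// invr_ge0 ltW//.
Qed.

Lemma integral_powRy_le (b c : R) : 0 < b -> 0 < c ->
  (\int[mu]_(x in `[c, +oo[) (x `^ (- b - 1))%:E <= (b^-1 * c `^ (- b))%:E)%E.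
Proof.
move=> b0 c0.
rewrite itv_bndy_bigcup_BRight.
apply: ge0_integral_bigcup_le => //.
- move=> m n mn; rewrite subsetEset => x /=; rewrite !in_itv/= => /andP[-> h]/=.
  by rewrite (le_trans h)// lerD2l ler_nat.
- by move=> n; exact: measurable_powR_EFin.
- by move=> n x _; rewrite lee_fin powR_ge0.
move=> n; rewrite integral_powR_itv ?lerDl// ?oppr_eq0 ?gt_eqF//.
rewrite lee_fin invrN !mulNr opprK gerDr oppr_le0 mulr_ge0 ?powR_ge0//.
by rewrite invr_ge0 ltW.
Qed.

Lemma integral_inv_itv (a c : R) : 0 < a -> a <= c ->
  (\int[mu]_(x in `[a, c]) (x^-1)%:E = (ln c - ln a)%:E)%E.
Proof.
move=> a0 ac.
apply: (FTC2_pos a0 ac (fun x x0 => is_derive1_ln x0)) => x x0.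
by apply: inv_continuous; rewrite gt_eqF.
Qed.

End power_integrals.

(** * Fourier inversion *)

Section integrability.
Context d (T : measurableType d) (R : realType).
Variables (mu : {measure set T -> \bar R}) (D : set T) (mD : measurable D).
Implicit Types f h : T -> R.

Lemma EFin_Rintegral f : mu.-integrable D (EFin \o f) ->
  (\int[mu]_(x in D) (f x)%:E)%E = (\int[mu]_(x in D) f x)%:E.
Proof. by move=> intf; rewrite fineK//; exact: integrable_fin_num. Qed.

Lemma integrable_bounded_mul (M : R) h f :
  measurable_fun D h -> (forall x, D x -> `|h x| <= M) ->
  mu.-integrable D (EFin \o f) ->
  mu.-integrable D (EFin \o (fun x => h x * f x)).
Proof.
move=> mh hM intf.
have mf : measurable_fun D f by apply/measurable_EFinP; exact: measurable_int intf.
have : mu.-integrable D (fun x => M%:E * (abse \o (EFin \o f)) x)%E.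
  by apply: integrableZl => //; exact: integrable_abse.
apply: le_integrable => //.
- by apply/measurable_EFinP; exact: measurable_funM.
- move=> x Dx /=; rewrite lee_fin normrM.
  by apply: le_trans (ler_norm _); rewrite ler_wpM2r// hM.
Qed.

Lemma integrable_scale c f : mu.-integrable D (EFin \o f) ->
  mu.-integrable D (EFin \o (fun x => c * f x)).
Proof.
move=> intf; apply: (@integrable_bounded_mul `|c| (cst c)) => //.
Qed.

Lemma integrable_dominated (g f : T -> R) :
  measurable_fun D f -> (forall x, D x -> `|f x| <= g x) ->
  mu.-integrable D (EFin \o g) -> mu.-integrable D (EFin \o f).
Proof.
move=> mf fg; apply: le_integrable => //.
  exact/measurable_EFinP.
by move=> x Dx /=; rewrite lee_fin (le_trans (fg x Dx))// ler_norm.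
Qed.

Lemma integrable_add f h : mu.-integrable D (EFin \o f) ->
  mu.-integrable D (EFin \o h) ->
  mu.-integrable D (EFin \o (fun x => f x + h x)).
Proof. by move=> intf inth; apply: (integrableD mD intf inth). Qed.

Lemma integrable_sub f h : mu.-integrable D (EFin \o f) ->
  mu.-integrable D (EFin \o h) ->
  mu.-integrable D (EFin \o (fun x => f x - h x)).
Proof. by move=> intf inth; apply: (integrableB mD intf inth). Qed.

Lemma Rintegral_dist_le f h (g : T -> R) :
  mu.-integrable D (EFin \o f) -> mu.-integrable D (EFin \o h) ->
  mu.-integrable D (EFin \o g) ->
  (forall x, D x -> `|f x - h x| <= g x) ->
  `|\int[mu]_(x in D) f x - \int[mu]_(x in D) h x| <= \int[mu]_(x in D) g x.
Proof.
move=> intf inth intg fhg; rewrite -RintegralB//.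
have intfh := integrable_sub intf inth.
apply: le_trans (le_normr_Rintegral mD intfh) _.
by apply: le_Rintegral => //; exact: integrable_norm.
Qed.

End integrability.

Section cosine_inversion.
Context {R : realType}.
Local Notation mu := (@lebesgue_measure R).
Local Notation pos := (`[0, +oo[%classic : set R).

Lemma poisson_kernel_integrable (w y : R) : 0 < w ->
  mu.-integrable setT (EFin \o (fun x => w / (w ^+ 2 + (x - y) ^+ 2))) /\
  \int[mu]_x (w / (w ^+ 2 + (x - y) ^+ 2)) = pi.
Proof.
move=> w0.
have D0 (x : R) : 0 < w ^+ 2 + x ^+ 2 by rewrite ltr_wpDr ?sqr_ge0 ?exprn_gt0.
have mp : measurable_fun setT (fun x : R => w / (w ^+ 2 + x ^+ 2)).
  apply: continuous_measurable_fun => x; apply: cvgM; first exact: cvg_cst.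
  apply: cvgV; first by rewrite gt_eqF.
  apply: cvgD; [exact: cvg_cst | exact: exprn_continuous].
have E : (\int[mu]_x ((w / (w ^+ 2 + (x - y) ^+ 2))%:E) = pi%:E)%E.
  rewrite (ge0_integral_shift y (g := fun x => (w / (w ^+ 2 + x ^+ 2))%:E)).
  - exact: integral_poisson_kernel.
  - exact/measurable_EFinP.
  - by move=> x; rewrite lee_fin divr_ge0 ?ltW.
split; last by rewrite /Rintegral E.
apply/integrableP; split.
  apply/measurable_EFinP.
  apply: (measurableT_comp mp); exact: measurable_funB.
under eq_integral.
  move=> x _ /=; rewrite ger0_norm; last by rewrite divr_ge0 ?ltW.
  over.
by rewrite E ltry.
Qed.

Variables (f phi : R -> R) (y : R).
Hypothesis intf : mu.-integrable setT (EFin \o f).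
Hypothesis cosf : forall xi, 0 <= xi -> \int[mu]_x (cos (xi * x) * f x) = phi xi.
Hypothesis sinf : forall xi, \int[mu]_x (sin (xi * x) * f x) = 0.

Let mf : measurable_fun setT f.
Proof. by apply/measurable_EFinP; exact: measurable_int intf. Qed.

(** The real part of the Fourier transform of a translate of f; the sine part
    disappears because the sine transform of f does. *)
Lemma integral_cos_shift (xi : R) : 0 <= xi ->
  (\int[mu]_x (f x * cos (xi * (x - y)))%:E = (cos (xi * y) * phi xi)%:E)%E.
Proof.
move=> xi0.
have ic : mu.-integrable setT (EFin \o (fun x => cos (xi * x) * f x)).
  apply: (@integrable_bounded_mul _ _ _ _ _ _ 1) => //.
    by apply: continuous_measurable_fun; exact: continuous_cosM.
  by move=> x _; exact: norm_cos_le1.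
have is_ : mu.-integrable setT (EFin \o (fun x => sin (xi * x) * f x)).
  apply: (@integrable_bounded_mul _ _ _ _ _ _ 1) => //.
    by apply: continuous_measurable_fun; exact: continuous_sinM.
  by move=> x _; exact: norm_sin_le1.
have ic' := integrable_scale measurableT (cos (xi * y)) ic.
have is' := integrable_scale measurableT (sin (xi * y)) is_.
transitivity (\int[mu]_x (cos (xi * y) * (cos (xi * x) * f x) +
  sin (xi * y) * (sin (xi * x) * f x))%:E)%E.
  apply: eq_integral => x _; congr EFin.
  by rewrite mulrBr cosB; ring.
rewrite (EFin_Rintegral measurableT (integrable_add measurableT ic' is')).
rewrite RintegralD// !RintegralZl// cosf// sinf mulr0 addr0//.
Qed.

(** The Poisson kernel is the cosine transform of exp (- eta xi), so exchanging
    the two integrals turns the Poisson mean of f at y into an Abel mean of the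
    inversion integral. *)
Lemma poisson_regularization (eta : R) : 0 < eta ->
  (\int[mu]_x (f x * (eta / (eta ^+ 2 + (x - y) ^+ 2)))%:E =
   \int[mu]_(xi in pos) (expR (- (eta * xi)) * (cos (xi * y) * phi xi))%:E)%E.
Proof.
move=> eta0.
pose e := (fun xi => expR (- (eta * xi))) \_ pos.
have [eE ie] := integral_expRN eta0.
have me : measurable_fun setT e.
  apply/(measurable_restrictT _ _).1 => //.
  by apply/measurable_EFinP; exact: measurable_int ie.
have e0 xi : 0 <= e xi.
  by rewrite /e patchE; case: ifPn => // _; exact: expR_ge0.
pose F (p : R * R) : \bar R := (f p.1 * (e p.2 * cos (p.2 * (p.1 - y))))%:E.
have mF : measurable_fun setT F.
  apply/measurable_EFinP; apply: measurable_funM.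
    exact: (measurableT_comp mf measurable_fst).
  apply: measurable_funM; first exact: (measurableT_comp me measurable_snd).
  apply: measurableT_comp.
    by apply: continuous_measurable_fun; exact: continuous_cos.
  apply: measurable_funM; first exact: measurable_snd.
  by apply: measurable_funB => //; exact: measurable_fst.
have eT : (\int[mu]_xi (e xi)%:E = (eta^-1)%:E)%E.
  rewrite -eE [RHS]integral_mkcond; apply: eq_integral => xi _.
  by rewrite restrict_EFin.
have iF : (mu \x mu)%E.-integrable setT F.
  apply/(integrable12ltyP mu mu mF).
  apply: (@le_lt_trans _ _ (\int[mu]_x (`|f x| * eta^-1)%:E)%E); last first.
    under eq_integral do rewrite mulrC EFinM.
    rewrite ge0_integralZl//.
    - apply: lte_mul_pinfty => //; first by rewrite lee_fin invr_ge0 ltW.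
      by move/integrableP : intf => [].
    - by apply/measurable_EFinP; apply: measurableT_comp => //.
    - by rewrite lee_fin invr_ge0 ltW.
  apply: le_integral_of_ge0 => x _; last first.
    by rewrite lee_fin mulr_ge0// invr_ge0 ltW.
  apply: (@le_trans _ _ (\int[mu]_xi (`|f x|%:E * (e xi)%:E))%E).
    apply: le_integral_of_ge0 => xi _; last by rewrite -EFinM lee_fin mulr_ge0.
    rewrite /F/= -EFinM lee_fin !normrM ler_wpM2l//.
    by rewrite (ger0_norm (e0 _)) ler_piMr// norm_cos_le1.
  rewrite ge0_integralZl ?eT//.
  - exact/measurable_EFinP.
  - by move=> xi _; rewrite lee_fin.
have := Fubini iF; rewrite /F/= => FE.
transitivity (\int[mu]_x \int[mu]_xi
    (f x * (e xi * cos (xi * (x - y))))%:E)%E.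
  apply: eq_integral => x _.
  have [ic cE] := integral_cos_expRN (x - y) eta0.
  rewrite -cE -RintegralZl// -EFin_Rintegral//; last exact: integrable_scale.
  rewrite integral_mkcond; apply: eq_integral => xi _.
  rewrite patchE /e patchE; case: ifPn => _; last by rewrite mul0r mulr0.
  by rewrite (mulrC xi).
rewrite FE [RHS]integral_mkcond; apply: eq_integral => xi _.
rewrite patchE /e patchE; case: ifPn => xi0; last first.
  by apply: integral0_eq => x _; rewrite mul0r mulr0.
have {}xi0 : 0 <= xi by move: xi0; rewrite inE/= in_itv/= andbT.
under eq_integral do rewrite mulrCA EFinM.
rewrite integralZl//; first by rewrite integral_cos_shift// EFinM.
under eq_fun do rewrite mulrC.
apply: (@integrable_bounded_mul _ _ _ _ _ _ 1) => //.
  apply: (measurableT_comp (f := fun u => cos (xi * u))).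
    by apply: continuous_measurable_fun; exact: continuous_cosM.
  exact: measurable_funB.
by move=> x _; exact: norm_cos_le1.
Qed.

End cosine_inversion.

Section inversion.
Context {R : realType}.
Local Notation mu := (@lebesgue_measure R).
Local Notation pos := (`[0, +oo[%classic : set R).

Lemma poisson_kernel_ge0 (w x y : R) : 0 < w -> 0 <= w / (w ^+ 2 + (x - y) ^+ 2).
Proof. by move=> w0; rewrite divr_ge0 ?(ltW w0)// addr_ge0 ?sqr_ge0. Qed.

Lemma measurable_poisson_kernel (w y : R) : 0 < w ->
  measurable_fun setT (fun x : R => w / (w ^+ 2 + (x - y) ^+ 2)).
Proof.
by move=> /(poisson_kernel_integrable y)[/measurable_int/measurable_EFinP].
Qed.

Lemma poisson_kernel_le (w x y : R) : 0 < w ->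
  `|w / (w ^+ 2 + (x - y) ^+ 2)| <= w^-1.
Proof.
move=> w0; rewrite ger0_norm ?poisson_kernel_ge0//.
rewrite ler_pdivrMr; last by rewrite ltr_wpDr ?sqr_ge0 ?exprn_gt0.
by rewrite mulrDr expr2 mulKf ?gt_eqF// lerDl mulr_ge0 ?sqr_ge0 ?invr_ge0 ?ltW.
Qed.

(** Off a neighbourhood of its centre the Poisson kernel is small with eta, both
    uniformly and relatively to the fixed integrable kernel of width 1. *)
Lemma poisson_kernel_tail (eta r u : R) : 0 < eta -> 0 < r -> r <= `|u| ->
  eta / (eta ^+ 2 + u ^+ 2) <= eta * r ^- 2 /\
  eta / (eta ^+ 2 + u ^+ 2) <= eta * (1 + r ^- 2) * (1 / (1 ^+ 2 + u ^+ 2)).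
Proof.
move=> eta0 r0 ru.
have r2u : r ^+ 2 <= u ^+ 2 by rewrite -(real_normK (num_real u)) lerXn2r ?nnegrE// ltW.
have r20 : 0 < r ^+ 2 by rewrite exprn_gt0.
have D0 : 0 < eta ^+ 2 + u ^+ 2 by rewrite ltr_pwDl ?exprn_gt0 ?sqr_ge0.
have u20 : 0 < u ^+ 2 by exact: lt_le_trans r2u.
split.
  rewrite ler_pM2l// lef_pV2 ?posrE// (le_trans r2u)// lerDr sqr_ge0//.
rewrite -mulrA ler_pM2l//.
apply: (@le_trans _ _ (u ^- 2)).
  by rewrite lef_pV2 ?posrE// lerDr sqr_ge0.
rewrite expr1n mul1r ler_pdivlMr; last by rewrite ltr_pwDl// ltW.
rewrite mulrDr mulr1 mulVf ?gt_eqF// addrC lerD2l.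
by rewrite lef_pV2 ?posrE.
Qed.

(** The integrand f x - f y is small near y; elsewhere the term with f x uses the
    uniform bound on the kernel (f is only integrable, not bounded) and the term
    with f y uses the integrable bound. *)
Lemma poisson_approximation (f : R -> R) (y e : R) :
  mu.-integrable setT (EFin \o f) -> {for y, continuous f} -> 0 < e ->
  exists2 C : R, 0 <= C & forall eta, 0 < eta ->
    `|\int[mu]_x (f x * (eta / (eta ^+ 2 + (x - y) ^+ 2))) - pi * f y|
      <= e * pi + eta * C.
Proof.
move=> intf cf e0.
have mf : measurable_fun setT f by apply/measurable_EFinP; exact: measurable_int intf.
have [r /= r0 hr] : exists2 r, 0 < r & forall x, `|x - y| < r -> `|f x - f y| <= e.
  move/cvgrPdist_le : cf => /(_ e e0) [r /= r0 hr]; exists r => // x xy.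
  by rewrite distrC; apply: hr; rewrite /ball/= distrC.
have inf := integrable_norm intf.
exists (r ^- 2 * \int[mu]_x `|f x| + `|f y| * (1 + r ^- 2) * pi) => [|eta eta0].
  have i0 : 0 <= r ^- 2 by rewrite invr_ge0 exprn_ge0// ltW.
  by rewrite addr_ge0// ?mulr_ge0 ?Rintegral_ge0 ?pi_ge0 ?addr_ge0.
have [ip pE] := poisson_kernel_integrable y eta0.
have [ip1 p1E] := poisson_kernel_integrable y (@ltr01 R).
have ifp : mu.-integrable setT
    (EFin \o (fun x => f x * (eta / (eta ^+ 2 + (x - y) ^+ 2)))).
  under eq_fun do rewrite mulrC.
  apply: (@integrable_bounded_mul _ _ _ _ _ _ eta^-1) => //.
  - exact: measurable_poisson_kernel.
  - by move=> x _; exact: poisson_kernel_le.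
have -> : pi * f y = \int[mu]_x (f y * (eta / (eta ^+ 2 + (x - y) ^+ 2))).
  by rewrite RintegralZl// pE mulrC.
have i1 := integrable_scale measurableT e ip.
have i2 := integrable_scale measurableT (eta * r ^- 2) inf.
have i3 := integrable_scale measurableT (`|f y| * (eta * (1 + r ^- 2))) ip1.
have i12 := integrable_add measurableT i1 i2.
have i123 := integrable_add measurableT i12 i3.
apply: (le_trans (Rintegral_dist_le measurableT ifp
  (integrable_scale measurableT (f y) ip) i123 _)).
  move=> x _; rewrite -mulrBl normrM (ger0_norm (poisson_kernel_ge0 x y eta0)).
  have p0 := poisson_kernel_ge0 x y eta0.
  have p10 := poisson_kernel_ge0 x y (@ltr01 R).
  have c0 : 0 <= eta * r ^- 2 by rewrite mulr_ge0 ?invr_ge0 ?exprn_ge0// ltW.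
  have c1 : 0 <= eta * (1 + r ^- 2).
    by rewrite mulr_ge0 ?addr_ge0 ?invr_ge0 ?exprn_ge0// ltW.
  have [xr|rx] := ltP `|x - y| r.
    rewrite -addrA (le_trans _ (_ : e * (eta / (eta ^+ 2 + (x - y) ^+ 2)) <= _))//.
      by rewrite ler_wpM2r// hr.
    rewrite lerDl; apply: addr_ge0; first exact: (mulr_ge0 c0 (normr_ge0 _)).
    exact: (mulr_ge0 (mulr_ge0 (normr_ge0 _) c1) p10).
  have [h1 h2] := poisson_kernel_tail eta0 r0 rx.
  rewrite (le_trans (_ : _ <= (`|f x| + `|f y|) * (eta / (eta ^+ 2 + (x - y) ^+ 2))))//.
    by rewrite ler_wpM2r// ler_normB.
  rewrite mulrDl lerD//; last by rewrite -mulrA ler_wpM2l.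
  rewrite (le_trans (_ : _ <= eta * r ^- 2 * `|f x|))//.
    by rewrite mulrC ler_wpM2r.
  by rewrite lerDr mulr_ge0// ltW.
rewrite RintegralD// RintegralD// (RintegralZl _ measurableT ip)
  (RintegralZl _ measurableT inf) (RintegralZl _ measurableT ip1) pE p1E.
by rewrite le_eqVlt; apply/orP; left; apply/eqP; rewrite /comp; ring.
Qed.

(** Compare the Poisson mean of f at y with its limit on both sides: the mean tends
    to pi f y by continuity, and the Abel factor costs at most eta times the
    first moment of phi, since 1 - exp (- eta xi) <= eta xi. *)
Lemma cosine_inversion (f phi : R -> R) (y : R) :
  mu.-integrable setT (EFin \o f) ->
  (forall xi, 0 <= xi -> \int[mu]_x (cos (xi * x) * f x) = phi xi) ->
  (forall xi, \int[mu]_x (sin (xi * x) * f x) = 0) ->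
  {for y, continuous f} ->
  (forall xi, 0 <= xi -> 0 <= phi xi) ->
  mu.-integrable pos (EFin \o phi) ->
  mu.-integrable pos (EFin \o (fun xi => xi * phi xi)) ->
  pi * f y = \int[mu]_(xi in pos) (cos (xi * y) * phi xi).
Proof.
move=> intf cosf sinf cf phi0 iphi ixphi.
set M := \int[mu]_(xi in pos) (xi * phi xi).
have M0 : 0 <= M.
  apply: Rintegral_ge0 => xi /=; rewrite in_itv/= andbT => xi0.
  by rewrite mulr_ge0// phi0.
have mcos : measurable_fun setT (fun xi : R => cos (xi * y)).
  under eq_fun do rewrite mulrC.
  by apply: continuous_measurable_fun; exact: continuous_cosM.
have icos : mu.-integrable pos (EFin \o (fun xi => cos (xi * y) * phi xi)).
  apply: (@integrable_bounded_mul _ _ _ _ _ _ 1) => //.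
    exact: measurable_funTS.
  by move=> xi _; exact: norm_cos_le1.
set I := \int[mu]_(xi in pos) _.
have step3 eta : 0 < eta ->
    `|\int[mu]_(xi in pos) (expR (- (eta * xi)) * (cos (xi * y) * phi xi)) - I|
    <= eta * M.
  move=> eta0; rewrite -RintegralZl//.
  apply: Rintegral_dist_le => //.
  - apply: (@integrable_bounded_mul _ _ _ _ _ _ 1) => //.
      apply: measurable_funTS; apply: continuous_measurable_fun.
      exact: continuous_expRN.
    move=> xi /=; rewrite in_itv/= andbT => xi0.
    rewrite ger0_norm ?expR_ge0// -expR0 ler_expR oppr_le0 mulr_ge0//.
    exact: ltW.
  - exact: integrable_scale.
  - move=> xi /=; rewrite in_itv/= andbT => xi0.
    have p0 := phi0 xi xi0.
    have -> : expR (- (eta * xi)) * (cos (xi * y) * phi xi) -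
        cos (xi * y) * phi xi =
      (expR (- (eta * xi)) - 1) * cos (xi * y) * phi xi by ring.
    rewrite !normrM mulrA (ger0_norm p0) ler_wpM2r//.
    rewrite -[leRHS]mulr1 ler_pM// ?norm_cos_le1//.
    have h1 : expR (- (eta * xi)) <= 1.
      by rewrite -expR0 ler_expR oppr_le0 mulr_ge0// ltW.
    have := expR_ge1Dx (- (eta * xi)).
    by rewrite ler0_norm ?subr_le0//; lra.
apply/eqP; rewrite -subr_eq0 -normr_eq0 eq_le normr_ge0 andbT.
apply/ler_addgt0Pl => e e0; rewrite addr0.
have pi0 := @pi_gt0 R.
have e1 : 0 < e / 2 / pi by rewrite !divr_gt0.
have [C C0 HC] := poisson_approximation intf cf e1.
have S0 : 0 < C + M + 1 by rewrite ltr_pwDr// addr_ge0.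
pose eta := e / 2 / (C + M + 1).
have eta0 : 0 < eta by rewrite !divr_gt0.
have := HC _ eta0; have := step3 _ eta0.
have -> : \int[mu]_x (f x * (eta / (eta ^+ 2 + (x - y) ^+ 2))) =
    \int[mu]_(xi in pos) (expR (- (eta * xi)) * (cos (xi * y) * phi xi)).
  by rewrite /Rintegral (poisson_regularization y intf cosf sinf eta0).
set J := \int[mu]_(xi in pos) _ => h1 h2.
have -> : pi * f y - I = (J - I) - (J - pi * f y) by ring.
apply: (le_trans (ler_normB _ _)); apply: (le_trans (lerD h1 h2)).
rewrite divfK ?gt_eqF//.
have : eta * (C + M + 1) = e / 2 by rewrite divfK// gt_eqF.
nra.
Qed.

End inversion.

(** * Bounds on the fundamental solution *)

Section stable_density.
Context {R : realType}.
Local Notation mu := (@lebesgue_measure R).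
Local Notation pos := (`[0, +oo[%classic : set R).

Lemma lipschitz1 (f df : R -> R) (a b : R) :
  (forall x : R, is_derive x 1 f (df x)) -> (forall x, `|df x| <= 1) ->
  `|f a - f b| <= `|a - b|.
Proof.
move=> dF d1; wlog ab : a b / b <= a.
  move=> h; have [ab|/ltW ab] := leP b a; first exact: h.
  by rewrite distrC (distrC a) h.
have [|c _ ->] := @MVT_segment _ f df b a ab (fun x _ => dF x).
  by apply: continuous_subspaceT; exact: is_derive_continuous dF.
by rewrite normrM ler_piMl.
Qed.

Lemma cos_lipschitz (a b : R) : `|cos a - cos b| <= `|a - b|.
Proof.
by apply: lipschitz1 => x; rewrite normrN norm_sin_le1.
Qed.

Lemma sin_lipschitz (a b : R) : `|sin a - sin b| <= `|a - b|.
Proof. by apply: lipschitz1 => x; exact: norm_cos_le1. Qed.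

(** Replaces the exponential of - v^a by e times the exponential of - v, so that
    only explicit exponential integrals are needed. *)
Lemma le_powR_add1 (a v : R) : 1 <= a -> 0 <= v -> v <= v `^ a + 1.
Proof.
move=> a1 v0; have [v1|/ltW v1] := leP v 1.
  by rewrite (le_trans v1)// lerDr powR_ge0.
by rewrite (le_trans (le1r_powR v1 a1))// lerDl.
Qed.

Lemma mul_expRN_le (v : R) : v * expR (- v) <= 2 * expR (- (2^-1 * v)).
Proof.
have -> : - v = - (2^-1 * v) + - (2^-1 * v) by field.
rewrite expRD mulrA ler_wpM2r ?expR_ge0//.
have := expR_ge1Dx (2^-1 * v); have := expRxMexpNx_1 (2^-1 * v).
have := expR_gt0 (- (2^-1 * v)); have := expR_gt0 (2^-1 * v).
nra.
Qed.

Variables (alpha s : R).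
Hypotheses (alpha1 : 1 < alpha) (alpha2 : alpha <= 2) (s0 : 0 < s).
Local Notation q := (s `^ alpha^-1).
Local Notation e := (expR 1).

Definition stable_cf (xi : R) : R := expR (- (s * xi `^ alpha)).
(** Minus the derivative of [stable_cf]. *)
Definition stable_cf' (xi : R) : R :=
  s * (alpha * xi `^ (alpha - 1)) * stable_cf xi.
Local Notation phi := stable_cf.
Local Notation psi := stable_cf'.

Let alpha0 : 0 < alpha. Proof. exact: lt_trans alpha1. Qed.

Let q0 : 0 < q. Proof. exact: powR_gt0. Qed.

(* q is the inverse of the frequency scale: all integrals below are in q xi. *)
Let scaling xi : 0 <= xi -> s * xi `^ alpha = (q * xi) `^ alpha.
Proof.
move=> xi0; rewrite powRM ?(ltW q0)// -powRrM mulVf ?gt_eqF//.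
by rewrite powRr1 ?ltW.
Qed.

Lemma stable_cf_ge0 xi : 0 <= phi xi. Proof. exact: expR_ge0. Qed.

Lemma stable_cf'_ge0 xi : 0 <= psi xi.
Proof. by rewrite !mulr_ge0 ?powR_ge0 ?expR_ge0 ?ltW. Qed.

Lemma stable_cf_le xi : 0 <= xi -> phi xi <= e * expR (- (q * xi)).
Proof.
move=> xi0; rewrite /phi scaling// -expRD ler_expR.
have := @le_powR_add1 alpha (q * xi) (ltW alpha1) (mulr_ge0 (ltW q0) xi0).
lra.
Qed.

Lemma mul_stable_cf_le xi : 0 <= xi ->
  xi * phi xi <= 2 * e / q * expR (- (q / 2 * xi)).
Proof.
move=> xi0; rewrite -(ler_pM2l q0) !mulrA.
apply: (@le_trans _ _ (q * xi * (e * expR (- (q * xi))))).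
  by rewrite ler_wpM2l ?mulr_ge0 ?(ltW q0)// stable_cf_le.
rewrite mulrCA.
apply: (@le_trans _ _ (e * (2 * expR (- (2^-1 * (q * xi)))))).
  by rewrite ler_wpM2l ?expR_ge0// mul_expRN_le.
rewrite le_eqVlt; apply/orP; left; apply/eqP.
have -> : 2^-1 * (q * xi) = q / 2 * xi by field.
by field; rewrite gt_eqF.
Qed.

Lemma mul_stable_cf'_le xi : 0 <= xi ->
  xi * psi xi <= 8 * e * expR (- (q / 2 * xi)).
Proof.
move=> xi0; set v := q * xi.
have v0 : 0 <= v by rewrite mulr_ge0// ltW.
have -> : xi * psi xi = alpha * (v `^ alpha * expR (- (v `^ alpha))).
  rewrite /psi /phi scaling// -/v -(scaling xi0).
  rewrite -(mulr_powRB1 xi0 alpha0) /=.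
  by ring.
have h1 := mul_expRN_le (v `^ alpha).
have h2 : expR (- (2^-1 * v `^ alpha)) <= e * expR (- (q / 2 * xi)).
  rewrite -expRD ler_expR.
  have -> : q / 2 * xi = 2^-1 * v by rewrite /v; field.
  by have := le_powR_add1 (ltW alpha1) v0; lra.
have h3 : 0 <= v `^ alpha * expR (- v `^ alpha).
  by rewrite mulr_ge0 ?powR_ge0 ?expR_ge0.
have h4 : 0 <= e * expR (- (q / 2 * xi)) by rewrite mulr_ge0 ?expR_ge0.
move: alpha2 alpha0 h1 h2 h3 h4; nra.
Qed.

Lemma within_continuous_stable_cf : {within pos, continuous phi}.
Proof.
have h : {within pos, continuous (fun xi => - (s * xi `^ alpha))}.
  move=> x; apply: cvgN; apply: cvgM; first exact: cvg_cst.
  exact: (powR_continuous_half_line alpha0).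
move=> x; apply: (cvg_comp _ expR (h x)).
exact: continuous_expR.
Qed.

Lemma within_continuous_stable_cf' : {within pos, continuous psi}.
Proof.
move=> x; apply: cvgM; last exact: within_continuous_stable_cf.
apply: cvgM; first exact: cvg_cst.
apply: cvgM; first exact: cvg_cst.
by apply: (powR_continuous_half_line _); rewrite subr_gt0.
Qed.

Lemma is_derive_stable_cf (xi : R) : 0 < xi -> is_derive xi 1 phi (- psi xi).
Proof.
move=> xi0.
have h : is_derive xi 1 (fun x => (- s) * x `^ alpha) (- s * (alpha * xi `^ (alpha - 1))).
  by apply: is_derive1_cmul; exact: is_derive1_powR.
have := is_derive1_comp (is_derive_expR _) h.
have -> : expR \o (fun x => - s * x `^ alpha) = phi.
  by apply/funext => x; rewrite /phi/= mulNr.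
by move=> h1; apply: (is_derive_eq h1); rewrite /psi /phi mulNr; ring.
Qed.

Lemma cvg_stable_cf : phi xi @[xi --> +oo] --> (0 : R).
Proof.
apply: (@squeeze_cvgr _ _ _ _ (cst 0) (fun x => e * expR (- (q * x)))).
- by near=> x; rewrite stable_cf_ge0/= stable_cf_le.
- exact: cvg_cst.
- rewrite -[X in _ --> X](mulr0 e); apply: cvgM; first exact: cvg_cst.
  exact: cvg_expRN.
Unshelve. all: end_near. Qed.

Let pos_ge0 x : pos x -> 0 <= x.
Proof. by rewrite /= in_itv/= andbT. Qed.

Lemma integrable_exp_dominated (a C : R) (f : R -> R) : 0 < a ->
  measurable_fun pos f ->
  (forall xi, 0 <= xi -> `|f xi| <= C * expR (- (a * xi))) ->
  mu.-integrable pos (EFin \o f) /\ \int[mu]_(xi in pos) `|f xi| <= C / a.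
Proof.
move=> a0 mf fC; have [aE ia] := integral_expRN a0.
have iC : mu.-integrable pos (EFin \o (fun xi => C * expR (- (a * xi)))).
  exact: integrable_scale.
have if_ : mu.-integrable pos (EFin \o f).
  apply: (@integrable_dominated _ _ _ mu pos _
    (fun xi => C * expR (- (a * xi)))) => //.
  by move=> x /pos_ge0; exact: fC.
split => //.
apply: (@le_trans _ _ (\int[mu]_(xi in pos) (C * expR (- (a * xi))))).
  apply: le_Rintegral => //; first exact: integrable_norm.
  by move=> x /pos_ge0; exact: fC.
by rewrite RintegralZl// /Rintegral aE.
Qed.

Let mphi : measurable_fun pos phi.
Proof. exact: measurable_half_line within_continuous_stable_cf. Qed.
Let mpsi : measurable_fun pos psi.
Proof. exact: measurable_half_line within_continuous_stable_cf'. Qed.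

Lemma integral_stable_cf :
  mu.-integrable pos (EFin \o phi) /\ \int[mu]_(xi in pos) `|phi xi| <= e / q.
Proof.
apply: integrable_exp_dominated => // xi xi0.
by rewrite ger0_norm ?stable_cf_ge0// stable_cf_le.
Qed.

Lemma integral_mul_stable_cf :
  mu.-integrable pos (EFin \o (fun xi => xi * phi xi)) /\
  \int[mu]_(xi in pos) `|xi * phi xi| <= 4 * e / q ^+ 2.
Proof.
have -> : 4 * e / q ^+ 2 = (2 * e / q) / (q / 2) by field; rewrite gt_eqF.
apply: integrable_exp_dominated => //; first by rewrite divr_gt0.
  by apply: measurable_funM.
move=> xi xi0.
by rewrite ger0_norm ?mulr_ge0 ?stable_cf_ge0// mul_stable_cf_le.
Qed.

Lemma integral_mul_stable_cf' :
  mu.-integrable pos (EFin \o (fun xi => xi * psi xi)) /\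
  \int[mu]_(xi in pos) `|xi * psi xi| <= 16 * e / q.
Proof.
have -> : 16 * e / q = (8 * e) / (q / 2) by field; rewrite gt_eqF.
apply: integrable_exp_dominated => //; first by rewrite divr_gt0.
  by apply: measurable_funM.
move=> xi xi0.
by rewrite (ger0_norm (mulr_ge0 xi0 (stable_cf'_ge0 xi))) mul_stable_cf'_le.
Qed.

Lemma integrable_stable_cf' : mu.-integrable pos (EFin \o psi).
Proof.
apply: (proj2 (@ge0_FTC2y _ psi (fun x => - phi x) 0 _ _ _ _ _)).
- by move=> x _; exact: stable_cf'_ge0.
- exact: within_continuous_stable_cf'.
- by move=> x; apply: cvgN; exact: within_continuous_stable_cf.
- move=> x x0.
  by apply: (is_derive_eq (is_deriveN (is_derive_stable_cf x0))); rewrite opprK.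
- by rewrite -oppr0; apply: cvgN; exact: cvg_stable_cf.
Qed.

End stable_density.

Section increments.
Context {R : realType}.
Local Notation mu := (@lebesgue_measure R).
Local Notation pos := (`[0, +oo[%classic : set R).
Variables (alpha s : R).
Hypotheses (alpha1 : 1 < alpha) (alpha2 : alpha <= 2) (s0 : 0 < s).
Local Notation q := (s `^ alpha^-1).
Local Notation e := (expR 1).
Local Notation phi := (stable_cf alpha s).
Local Notation psi := (stable_cf' alpha s).

Let q0 : 0 < q. Proof. exact: powR_gt0. Qed.

Let pos_ge0 x : pos x -> 0 <= x.
Proof. by rewrite /= in_itv/= andbT. Qed.

Let cphi := @within_continuous_stable_cf R alpha s alpha1.
Let cpsi := @within_continuous_stable_cf' R alpha s alpha1.
Let phi0 : forall xi, 0 <= phi xi := stable_cf_ge0 alpha s.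
Let psi0 : forall xi, 0 <= psi xi := stable_cf'_ge0 alpha1 s0.

Lemma integrable_bounded_stable_cf (f h : R -> R) :
  mu.-integrable pos (EFin \o f) -> continuous h -> (forall x, `|h x| <= 1) ->
  mu.-integrable pos (EFin \o (fun xi => h xi * f xi)).
Proof.
move=> intf ch h1; apply: (@integrable_bounded_mul _ _ _ _ _ _ 1) => //.
by apply: measurable_funTS; exact: continuous_measurable_fun.
Qed.

(** The derivative of sin (y xi) phi(xi), whose boundary terms vanish. This is
    where one power of decay in y is gained. *)
Lemma integral_cos_by_parts (y : R) :
  y * \int[mu]_(xi in pos) (cos (y * xi) * phi xi) =
  \int[mu]_(xi in pos) (sin (y * xi) * psi xi).
Proof.
have [iphi _] := integral_stable_cf alpha1 s0.
have ipsi := integrable_stable_cf' alpha1 s0.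
have ic := integrable_bounded_stable_cf iphi (@continuous_cosM R y)
  (fun x => norm_cos_le1 _).
have is_ := integrable_bounded_stable_cf ipsi (@continuous_sinM R y)
  (fun x => norm_sin_le1 _).
pose F xi := sin (y * xi) * phi xi.
pose g xi := `|y| * e * expR (- (q * xi)) + psi xi.
pose G xi := (`|y| * e) * (- q^-1 * expR (- (q * xi))) + - phi xi.
suff [_] : mu.-integrable pos
      (EFin \o (fun xi => y * (cos (y * xi) * phi xi) - sin (y * xi) * psi xi)) /\
    \int[mu]_(xi in pos)
      (y * (cos (y * xi) * phi xi) - sin (y * xi) * psi xi) = 0 - F 0.
  rewrite RintegralB//; last exact: integrable_scale.
  rewrite RintegralZl// /F mulr0 sin0 mul0r subr0.
  by move/eqP; rewrite subr_eq0 => /eqP.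
have dF (x : R) : 0 < x ->
    is_derive x 1 F (y * (cos (y * x) * phi x) - sin (y * x) * psi x).
  move=> x0.
  apply: (is_derive_eq (is_derive1_mul (is_derive1_sinM y x)
    (is_derive_stable_cf alpha s x0))).
  by ring.
have dG (x : R) : 0 < x -> is_derive x 1 G (g x).
  move=> x0; apply: (is_derive_eq (is_deriveD
    (is_derive1_cmul (`|y| * e) (is_derive_primitive_expRN x q0))
    (is_deriveN (is_derive_stable_cf alpha s x0)))).
  by rewrite opprK.
apply: (@dominated_FTC2y _ _ F g G 0 0).
- move=> x x0; rewrite /g (le_trans (ler_normB _ _))// lerD//.
    rewrite !normrM -mulrA ler_wpM2l// (ger0_norm (phi0 x)).
    apply: le_trans (stable_cf_le alpha1 s0 x0).
    by rewrite ler_piMl// norm_cos_le1.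
  by rewrite normrM (ger0_norm (psi0 x)) ler_piMl// norm_sin_le1.
- move=> x; apply: cvgB.
    apply: cvgM; first exact: cvg_cst.
    apply: cvgM; last exact: cphi.
    by apply: continuous_subspaceT; exact: continuous_cosM.
  apply: cvgM; last exact: cpsi.
  by apply: continuous_subspaceT; exact: continuous_sinM.
- move=> x; apply: cvgM; last exact: cphi.
  by apply: continuous_subspaceT; exact: continuous_sinM.
- apply: norm_cvg0.
  apply: (@squeeze_cvgr _ _ _ _ (cst 0) phi).
  + near=> x; rewrite normr_ge0/= normrM (ger0_norm (phi0 x)).
    by rewrite ler_piMl// norm_sin_le1.
  + exact: cvg_cst.
  + exact: cvg_stable_cf.
- move=> x; apply: cvgD; last exact: cpsi.
  apply: cvgM; first exact: cvg_cst.
  by apply: continuous_subspaceT; exact: continuous_expRN.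
- move=> x; apply: cvgD; last by apply: cvgN; exact: cphi.
  apply: cvgM; first exact: cvg_cst.
  apply: cvgM; first exact: cvg_cst.
  by apply: continuous_subspaceT; exact: continuous_expRN.
- rewrite -[X in _ --> X](addr0 0); apply: cvgD; last first.
    by rewrite -oppr0; apply: cvgN; exact: cvg_stable_cf.
  rewrite -[X in _ --> X](mulr0 (`|y| * e)); apply: cvgM; first exact: cvg_cst.
  rewrite -[X in _ --> X](mulr0 (- q^-1)); apply: cvgM; first exact: cvg_cst.
  exact: cvg_expRN.
Unshelve. all: end_near. Qed.

Variable G : R -> R.
Hypothesis GE : forall y, pi * G y = \int[mu]_(xi in pos) (cos (y * xi) * phi xi).

Let pi1 : 1 <= pi :> R. Proof. by apply: le_trans (pi_ge2 R); rewrite ler1n. Qed.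

Let icos y : mu.-integrable pos (EFin \o (fun xi => cos (y * xi) * phi xi)).
Proof.
exact: integrable_bounded_stable_cf (integral_stable_cf alpha1 s0).1
  (@continuous_cosM R y) (fun x => norm_cos_le1 _).
Qed.

Let isin y : mu.-integrable pos (EFin \o (fun xi => sin (y * xi) * psi xi)).
Proof.
exact: integrable_bounded_stable_cf (integrable_stable_cf' alpha1 s0)
  (@continuous_sinM R y) (fun x => norm_sin_le1 _).
Qed.

Lemma density_sup_le y : pi * `|G y| <= e / q.
Proof.
have [iphi iE] := integral_stable_cf alpha1 s0.
rewrite -(ger0_norm (pi_ge0 R)) -normrM GE.
apply: le_trans (le_normr_Rintegral _ (icos y)) _ => //.
apply: le_trans iE; apply: le_Rintegral => //; try exact: integrable_norm.
by move=> x _; rewrite normrM ler_piMl// norm_cos_le1.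
Qed.

Lemma density_increment_le y h : `|G (y + h) - G y| <= 17 * e * `|h| / q ^+ 2.
Proof.
have [iphi iE] := integral_mul_stable_cf alpha1 s0.
have inphi := integrable_norm iphi.
apply: (@le_trans _ _ (pi * `|G (y + h) - G y|)); first by rewrite ler_peMl.
rewrite -{1}(ger0_norm (pi_ge0 R)) -normrM mulrBr !GE.
apply: (@le_trans _ _ (\int[mu]_(xi in pos) (`|h| * `|xi * phi xi|))).
  apply: Rintegral_dist_le => //; first exact: integrable_scale.
  move=> x /pos_ge0 x0; rewrite -mulrBl normrM [`|x * _|]normrM mulrA.
  rewrite ler_wpM2r// (le_trans (cos_lipschitz _ _))//.
  by rewrite -mulrBl normrM [y + h]addrC addrK.
rewrite RintegralZl//.
apply: (le_trans (ler_wpM2l (normr_ge0 h) iE)).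
have : 0 <= `|h| * e / q ^+ 2 by rewrite !mulr_ge0 ?expR_ge0 ?invr_ge0 ?exprn_ge0// ltW.
have -> : `|h| * (4 * e / q ^+ 2) = 4 * (`|h| * e / q ^+ 2) by ring.
have -> : 17 * e * `|h| / q ^+ 2 = 17 * (`|h| * e / q ^+ 2) by ring.
lra.
Qed.

(** Differencing y G(y) rather than G(y) avoids any restriction on h against y:
    y (G(y + h) - G(y)) is the increment of y G(y), at most 16 e |h| / q by the
    integration by parts, minus h G(y + h), at most e |h| / q. *)
Lemma density_increment_decay y h :
  `|y| * `|G (y + h) - G y| <= 17 * e * `|h| / q.
Proof.
have [iphi iE] := integral_mul_stable_cf' alpha1 alpha2 s0.
have inphi := integrable_norm iphi.
apply: (@le_trans _ _ (pi * (`|y| * `|G (y + h) - G y|))).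
  by rewrite ler_peMl// mulr_ge0.
have -> : pi * (`|y| * `|G (y + h) - G y|) =
    `|((y + h) * (pi * G (y + h)) - y * (pi * G y)) - h * (pi * G (y + h))|.
  rewrite -{1}(ger0_norm (pi_ge0 R)) -!normrM; congr `|_|; ring.
apply: (le_trans (ler_normB _ _)).
have -> : 17 * e * `|h| / q = `|h| * (16 * e / q) + `|h| * (e / q) by ring.
apply: lerD; last first.
  by rewrite normrM ler_wpM2l// normrM (ger0_norm (pi_ge0 R)) density_sup_le.
rewrite !GE !integral_cos_by_parts.
apply: (@le_trans _ _ (\int[mu]_(xi in pos) (`|h| * `|xi * psi xi|))).
  apply: Rintegral_dist_le => //; first exact: integrable_scale.
  move=> x /pos_ge0 x0; rewrite -mulrBl normrM [`|x * _|]normrM mulrA.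
  rewrite ler_wpM2r// (le_trans (sin_lipschitz _ _))//.
  by rewrite -mulrBl normrM [y + h]addrC addrK.
rewrite RintegralZl//.
exact: ler_wpM2l.
Qed.

End increments.

Section fundamental_solution.
Context {R : realType}.
Local Notation mu := (@lebesgue_measure R).
Local Notation pos := (`[0, +oo[%classic : set R).

(** The pointwise inversion formula uses the continuity of [G s], which selects
    one representative among the densities with the given transform. *)
Lemma fundamental_solution_formula (alpha : R) (G : R -> R -> R) (s y : R) :
  1 < alpha -> is_fundamental_solution alpha G -> 0 < s ->
  pi * G s y = \int[mu]_(xi in pos) (cos (y * xi) * stable_cf alpha s xi).
Proof.
move=> alpha1 [cG GF] s0; have [iG cosG sinG] := GF s s0.
transitivity (\int[mu]_(xi in pos) (cos (xi * y) * stable_cf alpha s xi)); last first.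
  by apply: eq_Rintegral => xi _; rewrite (mulrC xi).
apply: cosine_inversion => //.
- by move=> xi xi0; rewrite cosG ger0_norm.
- apply: (@continuous_comp _ _ _ (fun x : R => (s, x))
    (fun p : R * R => G p.1 p.2) y); last exact: cG.
  exact: (@cvg_pair R R R (nbhs y) (nbhs s) (nbhs y) _ _ _ (cst s) id
    (@cvg_cst _ _ _ _ _) (@cvg_id _ _)).
- by move=> xi _; exact: stable_cf_ge0.
- exact: (integral_stable_cf alpha1 s0).1.
- exact: (integral_mul_stable_cf alpha1 s0).1.
Qed.

Lemma fundamental_solution_increment (alpha : R) (G : R -> R -> R) (s y h : R) :
  1 < alpha -> alpha <= 2 -> is_fundamental_solution alpha G -> 0 < s ->
  let q := s `^ alpha^-1 in
  `|G s (y + h) - G s y| <= 17 * expR 1 * `|h| / q ^+ 2 /\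
  `|y| * `|G s (y + h) - G s y| <= 17 * expR 1 * `|h| / q.
Proof.
move=> alpha1 alpha2 hG s0 q.
have GE x := fundamental_solution_formula x alpha1 hG s0.
split; [exact: density_increment_le | exact: density_increment_decay].
Qed.

End fundamental_solution.

(** * Time integrals *)

Section time_integrals.
Context {R : realType}.
Local Notation mu := (@lebesgue_measure R).

Lemma powR_le_neg (b u v : R) : b <= 0 -> 0 < u -> u <= v -> v `^ b <= u `^ b.
Proof.
move=> b0 u0 uv; have v0 := lt_le_trans u0 uv.
rewrite -(opprK b) !(powRN _ (- b)) lef_pV2 ?posrE ?powR_gt0//.
by rewrite ge0_ler_powR ?nnegrE ?oppr_ge0// ltW.
Qed.

Lemma half_powR_le (b : R) : - 1 <= b -> 2^-1 `^ b <= 2.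
Proof.
move=> b1; rewrite -[leRHS]invrK -[leRHS]powR_inv1 ?invr_ge0//.
by apply: ger_powR => //; apply/andP; split; lra.
Qed.

Definition trunc_pow (c b : R) : R -> R := (fun u : R => u `^ b) \_ `]0, c].
Definition tail_pow (c b : R) : R -> R := (fun u : R => u `^ b) \_ `[c, +oo[.

Lemma trunc_pow_ge0 c b u : 0 <= trunc_pow c b u.
Proof. by rewrite /trunc_pow patchE; case: ifPn => // _; exact: powR_ge0. Qed.

Lemma tail_pow_ge0 c b u : 0 <= tail_pow c b u.
Proof. by rewrite /tail_pow patchE; case: ifPn => // _; exact: powR_ge0. Qed.

Lemma trunc_powE c b u : 0 < u <= c -> trunc_pow c b u = u `^ b.
Proof. by move=> uc; rewrite /trunc_pow patchE ifT// inE/= in_itv/=. Qed.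

Lemma tail_powE c b u : c <= u -> tail_pow c b u = u `^ b.
Proof. by move=> uc; rewrite /tail_pow patchE ifT// inE/= in_itv/= andbT. Qed.

Lemma measurable_trunc_pow c b : measurable_fun setT (trunc_pow c b).
Proof.
apply/(measurable_restrictT _ _).1 => //; apply: measurable_funTS.
exact: measurable_powR.
Qed.

Lemma measurable_tail_pow c b : measurable_fun setT (tail_pow c b).
Proof.
apply/(measurable_restrictT _ _).1 => //; apply: measurable_funTS.
exact: measurable_powR.
Qed.

Lemma integral_trunc_pow_le (c b : R) : 0 < b -> 0 < c ->
  (\int[mu]_u (trunc_pow c (b - 1) u)%:E <= (b^-1 * c `^ b)%:E)%E.
Proof.
move=> b0 c0; apply: le_trans (integral_powR0_le b0 c0).
rewrite [leRHS]integral_mkcond le_eqVlt; apply/orP; left; apply/eqP.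
by apply: eq_integral => u _; rewrite restrict_EFin.
Qed.

Lemma integral_tail_pow_le (c b : R) : 0 < b -> 0 < c ->
  (\int[mu]_u (tail_pow c (- b - 1) u)%:E <= (b^-1 * c `^ (- b))%:E)%E.
Proof.
move=> b0 c0; apply: le_trans (integral_powRy_le b0 c0).
rewrite [leRHS]integral_mkcond le_eqVlt; apply/orP; left; apply/eqP.
by apply: eq_integral => u _; rewrite restrict_EFin.
Qed.

Section inner.
Variable H : R.
Hypotheses (H34 : 3 / 4 <= H) (H1 : H < 1).

(** The four terms of [inner_dom] contribute 2 / (1 - H), twice 2 / (2 H - 1), and
    2 / (1 - H), each times s ^ (H - 1). *)
Definition inner_const : R := 4 / (1 - H) + 4 / (2 * H - 1).

Lemma inner_const_gt0 : 0 < inner_const.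
Proof. by move: H34 H1 => ? ?; rewrite /inner_const addr_gt0// divr_gt0//; lra. Qed.

(** Majorant of |s - u|^(2H - 2) u^(-H) as a sum of pure powers, one for each
    region: near u = 0, on either side of the singularity u = s, and u > 2 s. *)
Definition inner_dom (s u : R) : R :=
  (s / 2) `^ (2 * H - 2) * trunc_pow (s / 2) (- H) u +
  (s / 2) `^ (- H) * (trunc_pow s (2 * H - 2) (s - u) + trunc_pow s (2 * H - 2) (u - s)) +
  2 * tail_pow s (H - 2) u.

Lemma inner_dom_ge0 s u : 0 <= inner_dom s u.
Proof.
rewrite /inner_dom; apply: addr_ge0; last first.
  by rewrite mulr_ge0 ?tail_pow_ge0.
by rewrite addr_ge0// mulr_ge0 ?addr_ge0 ?powR_ge0 ?trunc_pow_ge0.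
Qed.

Lemma inner_le_dom (s u : R) : 0 < s -> 0 < u ->
  `|s - u| `^ (2 * H - 2) * u `^ (- H) <= inner_dom s u.
Proof.
move: H34 H1 => h34 h1 s0 u0.
have A0 : 0 <= (s / 2) `^ (2 * H - 2) * trunc_pow (s / 2) (- H) u.
  by rewrite mulr_ge0 ?powR_ge0 ?trunc_pow_ge0.
have B0 : 0 <= (s / 2) `^ (- H) * trunc_pow s (2 * H - 2) (s - u).
  by rewrite mulr_ge0 ?powR_ge0 ?trunc_pow_ge0.
have C0 : 0 <= (s / 2) `^ (- H) * trunc_pow s (2 * H - 2) (u - s).
  by rewrite mulr_ge0 ?powR_ge0 ?trunc_pow_ge0.
have D0 : 0 <= 2 * tail_pow s (H - 2) u.
  by rewrite mulr_ge0 ?tail_pow_ge0.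
have b0 : 2 * H - 2 <= 0 by lra.
rewrite /inner_dom mulrDr.
have [us2|us2] := leP u (s / 2).
  apply: (@le_trans _ _ ((s / 2) `^ (2 * H - 2) * trunc_pow (s / 2) (- H) u)).
    rewrite trunc_powE ?u0// ler_wpM2r ?powR_ge0// powR_le_neg// ?divr_gt0//.
    by rewrite ger0_norm; lra.
  lra.
have uH : u `^ (- H) <= (s / 2) `^ (- H).
  by rewrite powR_le_neg ?divr_gt0//; lra.
have [us|us|us] := ltgtP u s.
- apply: (@le_trans _ _ ((s / 2) `^ (- H) * trunc_pow s (2 * H - 2) (s - u))).
    rewrite trunc_powE; last by apply/andP; split; lra.
    by rewrite ger0_norm ?subr_ge0 ?(ltW us)// mulrC ler_wpM2r// powR_ge0.
  lra.
- have [u2s|u2s] := leP u (2 * s).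
    apply: (@le_trans _ _ ((s / 2) `^ (- H) * trunc_pow s (2 * H - 2) (u - s))).
      rewrite trunc_powE; last by apply/andP; split; lra.
      by rewrite distrC ger0_norm ?subr_ge0 ?(ltW us)// mulrC ler_wpM2r// powR_ge0.
    lra.
  apply: (@le_trans _ _ (2 * tail_pow s (H - 2) u)); last by lra.
  rewrite tail_powE ?(ltW us)//.
  have -> : H - 2 = (2 * H - 2) + (- H) by ring.
  rewrite (@powRD _ u (2 * H - 2) (- H)); last by apply/implyP => _; rewrite gt_eqF.
  rewrite mulrA ler_wpM2r ?powR_ge0//.
  apply: (@le_trans _ _ ((u / 2) `^ (2 * H - 2))).
    apply: powR_le_neg => //; first by rewrite divr_gt0.
    by rewrite distrC ger0_norm; lra.
  rewrite powRM ?invr_ge0 ?(ltW u0)// mulrC ler_wpM2r ?powR_ge0//.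
  by apply: half_powR_le; lra.
- rewrite (_ : `|s - u| `^ (2 * H - 2) = 0) ?mul0r; first by lra.
  by rewrite us subrr normr0 powR0// lt_eqF//; lra.
Qed.

Lemma measurable_inner_dom s : measurable_fun setT (inner_dom s).
Proof.
apply: measurable_funD; last first.
  by apply: measurable_funM => //; exact: measurable_tail_pow.
apply: measurable_funD.
  by apply: measurable_funM => //; exact: measurable_trunc_pow.
apply: measurable_funM => //; apply: measurable_funD.
  apply: (measurableT_comp (measurable_trunc_pow _ _)); exact: measurable_funB.
apply: (measurableT_comp (measurable_trunc_pow _ _)); exact: measurable_funB.
Qed.

Lemma integral_inner_dom (s : R) : 0 < s ->
  (\int[mu]_u (inner_dom s u)%:E <= (inner_const * s `^ (H - 1))%:E)%E.
Proof.
move: H34 H1 => h34 h1 s0.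
have mt c b : measurable_fun setT (fun u => (trunc_pow c b u)%:E).
  by apply/measurable_EFinP; exact: measurable_trunc_pow.
have mtl c b : measurable_fun setT (fun u => (tail_pow c b u)%:E).
  by apply/measurable_EFinP; exact: measurable_tail_pow.
have t0 c b u : (0 <= (trunc_pow c b u)%:E)%E by rewrite lee_fin trunc_pow_ge0.
have tl0 c b u : (0 <= (tail_pow c b u)%:E)%E by rewrite lee_fin tail_pow_ge0.
have m1 : measurable_fun setT (fun u : R => (trunc_pow s (2 * H - 2) (s - u))%:E).
  by apply: (measurableT_comp (mt _ _)); exact: measurable_funB.
have m2 : measurable_fun setT (fun u : R => (trunc_pow s (2 * H - 2) (u - s))%:E).
  by apply: (measurableT_comp (mt _ _)); exact: measurable_funB.
have p0 (a b : R) : (0 <= (a `^ b)%:E)%E by rewrite lee_fin powR_ge0.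
have s20 : 0 < s / 2 by rewrite divr_gt0.
rewrite /inner_dom.
under eq_integral do rewrite !EFinD !EFinM EFinD.
have mA : measurable_fun setT
    (fun u => ((s / 2) `^ (2 * H - 2))%:E * (trunc_pow (s / 2) (- H) u)%:E)%E.
  exact: measurable_funeM.
have mB : measurable_fun setT (fun u : R => (trunc_pow s (2 * H - 2) (s - u))%:E +
    (trunc_pow s (2 * H - 2) (u - s))%:E)%E.
  exact: emeasurable_funD.
have mB' : measurable_fun setT (fun u : R => ((s / 2) `^ (- H))%:E *
    ((trunc_pow s (2 * H - 2) (s - u))%:E +
    (trunc_pow s (2 * H - 2) (u - s))%:E))%E.
  exact: measurable_funeM.
have mC : measurable_fun setT (fun u => 2%:E * (tail_pow s (H - 2) u)%:E)%E.
  exact: measurable_funeM.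
have C0 u : (0 <= 2%:E * (tail_pow s (H - 2) u)%:E)%E by rewrite mule_ge0.
have B0 u : (0 <= (trunc_pow s (2 * H - 2) (s - u))%:E +
    (trunc_pow s (2 * H - 2) (u - s))%:E)%E by rewrite adde_ge0.
have B0' u : (0 <= ((s / 2) `^ (- H))%:E * ((trunc_pow s (2 * H - 2) (s - u))%:E +
    (trunc_pow s (2 * H - 2) (u - s))%:E))%E by rewrite mule_ge0.
have A0 u : (0 <= ((s / 2) `^ (2 * H - 2))%:E * (trunc_pow (s / 2) (- H) u)%:E)%E.
  by rewrite mule_ge0.
have mAB := emeasurable_funD mA mB'.
rewrite ge0_integralD//; last by move=> u _; exact: adde_ge0.
rewrite ge0_integralD// !ge0_integralZl//; [|exact: mtl|exact: mt].
rewrite ge0_integralD//.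
rewrite (ge0_integral_reflection s (mt _ _) (t0 _ _)).
rewrite (ge0_integral_shift s (mt _ _) (t0 _ _)).
have k1 := @integral_trunc_pow_le (s / 2) (1 - H) ltac:(lra) s20.
have k2 := @integral_trunc_pow_le s (2 * H - 1) ltac:(lra) s0.
have k3 := @integral_tail_pow_le s (1 - H) ltac:(lra) s0.
have E1 : 1 - H - 1 = - H by ring.
have E2 : 2 * H - 1 - 1 = 2 * H - 2 by ring.
have E3 : - (1 - H) - 1 = H - 2 by ring.
rewrite E1 in k1; rewrite E2 in k2; rewrite E3 in k3.
have sne : s != 0 by rewrite gt_eqF.
have s2ne : s / 2 != 0 by rewrite gt_eqF.
have hs2 b : - 1 <= b -> b <= 0 -> (s / 2) `^ b <= 2 * s `^ b.
  move=> b1 b0; rewrite powRM ?invr_ge0 ?(ltW s0)// mulrC ler_wpM2r ?powR_ge0//.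
  by apply: half_powR_le; lra.
have g1 : ((s / 2) `^ (2 * H - 2) * ((1 - H)^-1 * (s / 2) `^ (1 - H)) <=
    2 / (1 - H) * s `^ (H - 1)).
  have -> : 2 / (1 - H) * s `^ (H - 1) = (1 - H)^-1 * (2 * s `^ (H - 1)) by ring.
  rewrite mulrCA; apply: ler_wpM2l; first by rewrite invr_ge0; lra.
  rewrite -powRD; last by apply/implyP => _.
  have -> : 2 * H - 2 + (1 - H) = H - 1 by ring.
  by apply: hs2; lra.
have g2 : ((s / 2) `^ (- H) * (2 * ((2 * H - 1)^-1 * s `^ (2 * H - 1))) <=
    4 / (2 * H - 1) * s `^ (H - 1)).
  apply: (@le_trans _ _ (2 * s `^ (- H) * (2 * ((2 * H - 1)^-1 * s `^ (2 * H - 1))))).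
    rewrite ler_wpM2r ?hs2 ?mulr_ge0 ?powR_ge0 ?invr_ge0//; lra.
  have -> : H - 1 = - H + (2 * H - 1) by ring.
  rewrite (@powRD _ s (- H) (2 * H - 1)); last by apply/implyP => _.
  by rewrite le_eqVlt; apply/orP; left; apply/eqP; ring.
have g3 : 2 * ((1 - H)^-1 * s `^ (- (1 - H))) = 2 / (1 - H) * s `^ (H - 1).
  by rewrite opprB mulrA.
apply: (@le_trans _ _ (2 / (1 - H) * s `^ (H - 1) +
  4 / (2 * H - 1) * s `^ (H - 1) + 2 / (1 - H) * s `^ (H - 1))%:E); last first.
  rewrite lee_fin /inner_const le_eqVlt; apply/orP; left; apply/eqP; ring.
rewrite !EFinD; apply: leeD; first apply: leeD.
- apply: le_trans (_ : (((s / 2) `^ (2 * H - 2) *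
    ((1 - H)^-1 * (s / 2) `^ (1 - H)))%:E <= _)%E); last first.
    by rewrite lee_fin.
  by rewrite EFinM lee_wpmul2l// lee_fin powR_ge0.
- apply: le_trans (_ : (((s / 2) `^ (- H) *
    (2 * ((2 * H - 1)^-1 * s `^ (2 * H - 1))))%:E <= _)%E); last first.
    by rewrite lee_fin.
  rewrite EFinM lee_wpmul2l//.
  have -> : 2 * ((2 * H - 1)^-1 * s `^ (2 * H - 1)) =
    (2 * H - 1)^-1 * s `^ (2 * H - 1) + (2 * H - 1)^-1 * s `^ (2 * H - 1).
    by ring.
  by rewrite EFinD leeD.
- by rewrite -g3 EFinM lee_wpmul2l// lee_fin.
Qed.

Lemma inner_time_integral (s t : R) : 0 < s ->
  (\int[mu]_(r in `]-oo, t[)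
     (`|s - (t - r)| `^ (2 * H - 2) * (t - r) `^ (- H))%:E <=
   (inner_const * s `^ (H - 1))%:E)%E.
Proof.
move=> s0; apply: le_trans (integral_inner_dom s0).
rewrite -(ge0_integral_reflection t (g := fun u => (inner_dom s u)%:E)).
- rewrite integral_mkcond; apply: le_integral_of_ge0 => r _.
    rewrite patchE; case: ifPn => rt.
      rewrite lee_fin inner_le_dom// subr_gt0.
      by move: rt; rewrite inE/= in_itv/=.
    by rewrite lee_fin inner_dom_ge0.
  by rewrite lee_fin inner_dom_ge0.
- by apply/measurable_EFinP; exact: measurable_inner_dom.
- by move=> u; rewrite lee_fin inner_dom_ge0.
Qed.

End inner.

(** What remains of the covariance after the integrations in space and in the
    other time variable, for c = 1 / (2 alpha). The two branches agree at
    s = delta. *)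
Definition outer_profile (delta c s : R) : R :=
  if s <= delta then delta `^ (- c) * s `^ (c - 1) else s `^ (- 1).

(** The part s <= delta contributes 1 / c whatever delta is; only the part
    delta < s <= T produces the logarithm. *)
Lemma outer_time_integral (delta c t T : R) :
  0 < c -> 0 < delta -> delta <= T -> t <= T ->
  (\int[mu]_(r in `[0%R, t[) (outer_profile delta c (t - r))%:E <=
   (c^-1 + (ln T - ln delta))%:E)%E.
Proof.
move=> c0 d0 dT tT.
pose inv := (fun u : R => u^-1) \_ `[delta, T].
pose V u := delta `^ (- c) * trunc_pow delta (c - 1) u + inv u.
have inv0 u : 0 <= inv u.
  rewrite /inv patchE; case: ifPn => //; rewrite inE/= in_itv/= => /andP[du _].
  by rewrite invr_ge0 ltW// (lt_le_trans d0).
have V0 u : 0 <= V u by rewrite addr_ge0// mulr_ge0 ?powR_ge0 ?trunc_pow_ge0.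
have minv : measurable_fun setT inv.
  apply/(measurable_restrictT _ _).1 => //.
  apply: subspace_continuous_measurable_fun => //.
  apply: continuous_in_subspaceT => x; rewrite inE/= in_itv/= => /andP[dx _].
  by apply: inv_continuous; rewrite gt_eqF// (lt_le_trans d0).
have mV : measurable_fun setT (fun u => (V u)%:E).
  apply/measurable_EFinP; apply: measurable_funD => //.
  by apply: measurable_funM => //; exact: measurable_trunc_pow.
apply: (@le_trans _ _ (\int[mu]_u (V u)%:E)%E).
  rewrite -(ge0_integral_reflection t (g := fun u => (V u)%:E))//.
  rewrite integral_mkcond; apply: le_integral_of_ge0 => r _; last by rewrite lee_fin.
  rewrite patchE; case: ifPn => [|_]; last by rewrite lee_fin.
  rewrite inE/= in_itv/= => /andP[r0 rt]; rewrite lee_fin /outer_profile /V.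
  have s0 : 0 < t - r by rewrite subr_gt0.
  have [sd|sd] := leP (t - r) delta.
    by rewrite trunc_powE ?s0// lerDl.
  rewrite powR_inv1 ?(ltW s0)// [inv _]patchE ifT; last first.
    by rewrite inE/= in_itv/=; apply/andP; split; lra.
  by rewrite lerDr mulr_ge0 ?powR_ge0 ?trunc_pow_ge0.
rewrite /V; under eq_integral do rewrite EFinD EFinM.
rewrite ge0_integralD//; last 4 first.
- by move=> u _; rewrite -EFinM lee_fin mulr_ge0 ?powR_ge0 ?trunc_pow_ge0.
- apply: measurable_funeM; apply/measurable_EFinP; exact: measurable_trunc_pow.
- by move=> u _; rewrite lee_fin.
- exact/measurable_EFinP.
rewrite ge0_integralZl//; last 3 first.
- apply/measurable_EFinP; exact: measurable_trunc_pow.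
- by move=> u _; rewrite lee_fin trunc_pow_ge0.
- by rewrite lee_fin powR_ge0.
rewrite EFinD; apply: leeD.
  apply: (@le_trans _ _ ((delta `^ (- c))%:E * (c^-1 * delta `^ c)%:E)%E).
    by rewrite lee_wpmul2l ?lee_fin ?powR_ge0// integral_trunc_pow_le.
  rewrite -EFinM mulrCA -powRD ?addNr ?powRr0 ?mulr1//.
  by rewrite eqxx/= gt_eqF.
rewrite -(integral_inv_itv d0 dT) [leRHS]integral_mkcond.
rewrite le_eqVlt; apply/orP; left; apply/eqP.
by apply: eq_integral => u _; rewrite restrict_EFin.
Qed.

End time_integrals.

(** * Measurability of the kernel *)

Section plane_measurability.
Context {R : realType}.

(** An open set of the plane is the union of the countably many rational squares
    that it contains. *)
Lemma open_measurable_plane (U : set (R * R)) : open U -> measurable U.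
Proof.
move=> oU.
pose B (i : rat * rat * nat) : set (R * R) :=
  ball (ratr i.1.1 : R) (i.2.+1%:R^-1) `*` ball (ratr i.1.2 : R) (i.2.+1%:R^-1).
pose F i : set (R * R) := if `[< B i `<=` U >] then B i else set0.
have -> : U = \bigcup_i F i.
  apply/seteqP; split => [p Up|p [i _]]; last first.
    by rewrite /F; case: ifPn => // /asboolP; exact.
  have : nbhs p U by exact: open_nbhs_nbhs.
  move=> /nbhs_ballP[e /= e0 eU].
  have e20 : 0 < e / 2 by rewrite divr_gt0.
  have [n] := ltr_add_invr e20; rewrite add0r => ne.
  set d : R := n.+1%:R^-1 in ne.
  have d0 : 0 < d by rewrite invr_gt0.
  have near_rat (u : R) : exists a : rat, ball u d (ratr a).
    have : ball u d `&` range ratr !=set0.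
      by apply: dense_rat; [exists u; exact: ballxx|exact: ball_open].
    by move=> [_ []] /[swap] -[a _ <-] h; exists a.
  have [a ha] := near_rat p.1; have [b hb] := near_rat p.2.
  have Bi : B (a, b, n) `<=` U.
    move=> z [/= hz1 hz2]; apply: eU.
    have de : d + d <= e by clear -ne; lra.
    split; apply: (le_ball de).
      exact: ball_triangle ha hz1.
    exact: ball_triangle hb hz2.
  exists (a, b, n) => //; rewrite /F ifT; last exact/asboolP.
  by split; exact: ball_sym.
apply: countable_bigcupT_measurable => // i.
rewrite /F; case: ifPn => // _; apply: measurableX;
  apply: open_measurable; exact: ball_open.
Qed.

Lemma continuous_measurable_plane (D : set (R * R)) (f : R * R -> R) :
  open D -> (forall p, D p -> {for p, continuous f}) -> measurable_fun D f.
Proof.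
move=> oD cf; apply: (measurability _ (RGenOpens.measurableE R)).
move=> _ [_ [a [b ->] <-]]; apply: open_measurable_plane.
rewrite openE => p [Dp fp]; apply: filterI; first exact: open_nbhs_nbhs.
by apply: (cf p Dp); apply: open_nbhs_nbhs; split => //; exact: interval_open.
Qed.

Lemma measurable_increment_kernel (alpha : R) (G : R -> R -> R) (C : set (R * R))
    (t x h : R) :
  is_fundamental_solution alpha G -> measurable C ->
  measurable_fun setT (increment_kernel G C t x h).
Proof.
move=> [cG _] mC.
pose O : set (R * R) := [set p | p.1 < t].
pose E : set (R * R) := C `&` [set q : R * R | 0 <= q.1 < t].
have oO : open O.
  apply: (@open_comp _ _ fst [set r : R | r < t]); last exact: open_lt.
  by move=> p _; exact: cvg_fst.
have EO : E `<=` O by move=> p [_ /= /andP[]].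
have mE : measurable E.
  apply: measurableI => //.
  rewrite (_ : [set q : R * R | _] = `[0, t[%classic `*` setT); last first.
    by apply/seteqP; split => p /=; rewrite in_itv/=; [|case].
  exact: measurableX.
pose Psi (p : R * R) := G (t - p.1) (x + h - p.2) - G (t - p.1) (x - p.2).
have -> : increment_kernel G C t x h = Psi \_ E.
  apply/funext => p; rewrite /increment_kernel patchE indicE.
  by case: (boolP (p \in E)) => _; rewrite ?mul1r ?mul0r.
apply/(measurable_restrictT _ _).1 => //.
apply: measurable_funS EO _; first exact: open_measurable_plane.
apply: continuous_measurable_plane => // p; rewrite /O/= => pt.
have cGc (c : R) : {for p, continuous (fun p : R * R => G (t - p.1) (c - p.2))}.
  apply: (@continuous_comp _ _ _ (fun p : R * R => (t - p.1, c - p.2))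
    (fun p : R * R => G p.1 p.2) p); last by apply: cG; rewrite subr_gt0.
  have c1 : (fun p : R * R => t - p.1) q @[q --> p] --> t - p.1.
    by apply: cvgB; [exact: cvg_cst|exact: cvg_fst].
  have c2 : (fun p : R * R => c - p.2) q @[q --> p] --> c - p.2.
    by apply: cvgB; [exact: cvg_cst|exact: cvg_snd].
  exact: (@cvg_pair _ R R (nbhs p) (nbhs (t - p.1)) (nbhs (c - p.2)) _ _ _ _ _ c1 c2).
by apply: cvgB; exact: cGc.
Qed.

Lemma measurable_far_set (t x delta eps : R) :
  measurable (far_set t x delta eps).
Proof. by apply: measurableD; apply: measurableX. Qed.

End plane_measurability.

(** * Space integrals *)

Section space_integral.
Context {R : realType}.
Local Notation mu := (@lebesgue_measure R).

(** Add the bounds on (w D)^2 and (y D)^2. When w < |y|, the first one follows from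
    the second. *)
Lemma poisson_dominated_sq (D y K q w : R) : 0 < q -> 0 < w -> 0 <= K ->
  `|D| <= K / q ^+ 2 -> `|y| * `|D| <= K / q -> w = q \/ w < `|y| ->
  D ^+ 2 <= 2 * (K / q) ^+ 2 / (w ^+ 2 + y ^+ 2).
Proof.
move=> q0 w0 K0 h1 h2 hw.
have D0 : 0 < w ^+ 2 + y ^+ 2 by rewrite ltr_pwDl ?exprn_gt0 ?sqr_ge0.
rewrite ler_pdivlMr//.
have -> : D ^+ 2 * (w ^+ 2 + y ^+ 2) = (w * `|D|) ^+ 2 + (`|y| * `|D|) ^+ 2.
  by rewrite !exprMn !real_normK ?num_real//; ring.
have wD : w * `|D| <= K / q.
  case: hw => [->|hw]; last first.
    by apply: le_trans h2; rewrite ler_wpM2r// ltW.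
  apply: (@le_trans _ _ (q * (K / q ^+ 2))); first by rewrite ler_pM2l.
  by rewrite le_eqVlt; apply/orP; left; apply/eqP; field; rewrite gt_eqF.
have kq : 0 <= K / q by rewrite divr_ge0// ltW.
have -> : 2 * (K / q) ^+ 2 = (K / q) ^+ 2 + (K / q) ^+ 2 by ring.
have wD0 : 0 <= w * `|D| by rewrite mulr_ge0// ltW.
have yD0 : 0 <= `|y| * `|D| by rewrite mulr_ge0.
by apply: lerD; rewrite lerXn2r ?nnegrE.
Qed.

(** The Cauchy-Schwarz inequality in its arithmetic-geometric form
    2 |u v| <= (b / a) u^2 + (a / b) v^2, the weights being chosen so that both
    terms have the same integral. *)
Lemma integral_poisson_dominated (x a b w1 w2 : R) (u v : R -> R) :
  0 < a -> 0 < b -> 0 < w1 -> 0 < w2 ->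
  (forall z, u z ^+ 2 <= a ^+ 2 * (w1 / (w1 ^+ 2 + (x - z) ^+ 2))) ->
  (forall z, v z ^+ 2 <= b ^+ 2 * (w2 / (w2 ^+ 2 + (x - z) ^+ 2))) ->
  (\int[mu]_z (`|u z| * `|v z|)%:E <= (pi * (a * b))%:E)%E.
Proof.
move=> a0 b0 w10 w20 hu hv.
have [i1 E1] := poisson_kernel_integrable x w10.
have [i2 E2] := poisson_kernel_integrable x w20.
pose P1 z := w1 / (w1 ^+ 2 + (z - x) ^+ 2).
pose P2 z := w2 / (w2 ^+ 2 + (z - x) ^+ 2).
have P10 z : 0 <= P1 z by exact: poisson_kernel_ge0.
have P20 z : 0 <= P2 z by exact: poisson_kernel_ge0.
apply: (@le_trans _ _ (\int[mu]_z ((a * b / 2) * P1 z + (a * b / 2) * P2 z)%:E)%E).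
  apply: le_integral_of_ge0 => z _; rewrite lee_fin; last first.
    by rewrite addr_ge0// mulr_ge0// divr_ge0// mulr_ge0// ltW.
  have := hu z; have := hv z.
  have -> : (x - z) ^+ 2 = (z - x) ^+ 2 by ring.
  rewrite -/(P1 z) -/(P2 z) => hv' hu'.
  have sq : 0 <= (b * `|u z| - a * `|v z|) ^+ 2 by rewrite sqr_ge0.
  have uE : `|u z| ^+ 2 = u z ^+ 2 by rewrite real_normK ?num_real.
  have vE : `|v z| ^+ 2 = v z ^+ 2 by rewrite real_normK ?num_real.
  have k1 : b ^+ 2 * `|u z| ^+ 2 <= b ^+ 2 * (a ^+ 2 * P1 z).
    by rewrite ler_wpM2l ?sqr_ge0// uE.
  have k2 : a ^+ 2 * `|v z| ^+ 2 <= a ^+ 2 * (b ^+ 2 * P2 z).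
    by rewrite ler_wpM2l ?sqr_ge0// vE.
  rewrite -(ler_pM2l (mulr_gt0 a0 b0)).
  move: sq k1 k2; rewrite sqrrB !exprMn.
  set U := `|u z|; set V := `|v z|; nra.
have ab0 : 0 <= a * b / 2 by rewrite divr_ge0// mulr_ge0// ltW.
rewrite (EFin_Rintegral (mu := mu) measurableT); last first.
  by apply: integrable_add => //; exact: integrable_scale.
rewrite RintegralD//; try exact: integrable_scale.
rewrite (RintegralZl _ measurableT i1) (RintegralZl _ measurableT i2) E1 E2.
by rewrite lee_fin le_eqVlt; apply/orP; left; apply/eqP; field.
Qed.

End space_integral.

(** * The covariance of the far increment *)

Section far_kernel.
Context {R : realType}.
Local Notation mu := (@lebesgue_measure R).

Variables (alpha H : R) (G : R -> R -> R).
Hypotheses (alpha1 : 1 < alpha) (alpha2 : alpha <= 2).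
Hypotheses (H34 : 3 / 4 <= H) (H1 : H < 1) (HE : H = 3 / 2 * alpha^-1).
Hypothesis hG : is_fundamental_solution alpha G.
Variables (t x h delta : R).
Hypotheses (h0 : 0 < h) (d0 : 0 < delta).

Local Notation p := (alpha^-1).
Local Notation eps := (delta `^ p).
Let f := increment_kernel G (far_set t x delta eps) t x h.
Let K : R := 17 * expR 1 * h.

Let K0 : 0 < K. Proof. by rewrite /K !mulr_gt0 ?expR_gt0. Qed.
Let p0 : 0 < p. Proof. by rewrite invr_gt0 (lt_trans _ alpha1). Qed.

(** At times s <= delta the far region is |y| > eps, so the kernel is spread over
    the width eps rather than over its natural width s ^ p <= eps. *)
Definition far_width (s : R) : R := if s <= delta then eps else s `^ p.

Lemma far_width_gt0 s : 0 < s -> 0 < far_width s.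
Proof. by move=> s0; rewrite /far_width; case: ifP => _; rewrite powR_gt0. Qed.

Lemma far_kernel_out (r z : R) : ~ (0 <= r < t) -> f (r, z) = 0.
Proof.
move=> rt; rewrite /f /increment_kernel indicE memNset ?mul0r//.
by move=> [_].
Qed.

Lemma far_kernel_sq (r z : R) : 0 <= r < t ->
  f (r, z) ^+ 2 <= 2 * (K / (t - r) `^ p) ^+ 2 /
    (far_width (t - r) ^+ 2 + (x - z) ^+ 2) /\
  f (r, z) ^+ 2 <= 2 * (K / (t - r) `^ p) ^+ 2 /
    (((t - r) `^ p) ^+ 2 + (x - z) ^+ 2).
Proof.
move=> /andP[r0 rt]; set s := t - r.
have s0 : 0 < s by rewrite subr_gt0.
have q0 : 0 < s `^ p by exact: powR_gt0.
have w0 := far_width_gt0 s0.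
pose D := G s (x - z + h) - G s (x - z).
have [] := fundamental_solution_increment (x - z) h alpha1 alpha2 hG s0.
rewrite -/D (gtr0_norm h0) -/K => D1 D2.
have fD : f (r, z) = 0 \/
    f (r, z) = D /\ (far_width s = s `^ p \/ far_width s < `|x - z|).
  rewrite /f /increment_kernel indicE/=.
  case: (boolP ((r, z) \in _)) => [|_]; last by left; rewrite mul0r.
  rewrite inE => -[[_ /= nnear] _]; right; split.
    by rewrite mul1r /D addrAC.
  rewrite /far_width; case: ifPn => [sd|_]; last by left.
  right; rewrite ltNge; apply/negP => xz; apply: nnear; split => /=.
    by rewrite in_itv/= (ltW rt) andbT; move: sd; rewrite /s; lra.
  by move: xz; rewrite in_itv/= ler_norml => /andP[? ?]; apply/andP; split; lra.
have pos c : 0 <= 2 * (K / s `^ p) ^+ 2 / (c ^+ 2 + (x - z) ^+ 2).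
  apply: divr_ge0; last by apply: addr_ge0; exact: sqr_ge0.
  by apply: mulr_ge0 => //; exact: sqr_ge0.
case: fD => [->|[-> hw]]; first by rewrite expr0n/=; split; exact: pos.
split.
  exact: (poisson_dominated_sq q0 w0 (ltW K0) D1 D2 hw).
exact: (poisson_dominated_sq q0 q0 (ltW K0) D1 D2 (or_introl erefl)).
Qed.

(* Up to a constant, bounds for the L2 norm of the kernel in space at time s:
   amp s uses the width far_width s, and amp' s the natural width s ^ p, for
   which the powers combine into s ^ (- H). *)
Let amp (s : R) : R := 2 * K * s `^ (- p) *
  (if s <= delta then delta `^ (- (p / 2)) else s `^ (- (p / 2))).
Let amp' (s : R) : R := 2 * K * s `^ (- H).

Let amp_gt0 s : 0 < s -> 0 < amp s.
Proof.
move=> s0; rewrite /amp !mulr_gt0 ?powR_gt0//.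
by case: ifP => _; rewrite powR_gt0.
Qed.

Let amp'_gt0 s : 0 < s -> 0 < amp' s.
Proof. by move=> s0; rewrite /amp' !mulr_gt0 ?powR_gt0. Qed.

Lemma powR_sqr (u b : R) : 0 < u -> (u `^ b) ^+ 2 = u `^ (2 * b).
Proof. by move=> u0; rewrite -powR_mulrn ?powR_ge0// -powRrM mulrC. Qed.

Let amp_sq s : 0 < s ->
  amp s ^+ 2 * far_width s = 4 * (K / s `^ p) ^+ 2.
Proof.
move=> s0; rewrite /amp /far_width.
have E u : 0 < u -> (u `^ (- (p / 2))) ^+ 2 * u `^ p = 1.
  move=> u0; rewrite powR_sqr// -powRD; last by apply/implyP => _; rewrite gt_eqF.
  by rewrite mulrN [2 * _]mulrC divfK ?addNr ?powRr0.
rewrite (powRN s p); case: ifP => _.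
  by rewrite exprMn -[LHS]mulrA E// mulr1; ring.
by rewrite exprMn -[LHS]mulrA E// mulr1; ring.
Qed.

Let amp'_sq s : 0 < s -> amp' s ^+ 2 * s `^ p = 4 * (K / s `^ p) ^+ 2.
Proof.
move=> s0; rewrite /amp' exprMn powR_sqr// -mulrA -powRD; last first.
  by apply/implyP => _; rewrite gt_eqF.
rewrite (_ : 2 * - H + p = (2 * - p)); last first.
  by rewrite HE; field; rewrite gt_eqF// (lt_trans _ alpha1).
by rewrite -powR_sqr// powRN exprMn; ring.
Qed.

Lemma far_space_integral (r r' : R) : 0 <= r < t -> 0 <= r' < t ->
  (\int[mu]_z (`|f (r, z)| * `|f (r', z)|)%:E <=
   (pi * (amp (t - r) * amp' (t - r')))%:E)%E.
Proof.
move=> rt r't.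
have s0 : 0 < t - r by rewrite subr_gt0; case/andP: rt.
have s'0 : 0 < t - r' by rewrite subr_gt0; case/andP: r't.
have K20 s : 0 <= (K / s `^ p) ^+ 2 by exact: sqr_ge0.
apply: (integral_poisson_dominated (x := x) (amp_gt0 s0) (amp'_gt0 s'0)
  (far_width_gt0 s0) (powR_gt0 p s'0)) => z.
- have [h1 _] := far_kernel_sq z rt; apply: (le_trans h1).
  rewrite mulrA amp_sq// ler_wpM2r ?invr_ge0 ?addr_ge0 ?sqr_ge0//.
  by rewrite ler_wpM2r// ler_nat.
- have [_ h1] := far_kernel_sq z r't; apply: (le_trans h1).
  rewrite mulrA amp'_sq// ler_wpM2r ?invr_ge0 ?addr_ge0 ?sqr_ge0//.
  by rewrite ler_wpM2r// ler_nat.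
Qed.

Let prefactor : R := pi * (2 * K) ^+ 2 * inner_const H.

Let prefactor_ge0 : 0 <= prefactor.
Proof.
by rewrite /prefactor !mulr_ge0 ?pi_ge0 ?sqr_ge0// ltW// inner_const_gt0.
Qed.

Lemma outer_profile_ge0 c s : 0 <= outer_profile delta c s.
Proof.
by rewrite /outer_profile; case: ifP => _; rewrite ?mulr_ge0 ?powR_ge0.
Qed.

(* The criticality H = 3 / (2 alpha) makes the exponent -1 for s > delta. *)
Let amp_outer s : 0 < s ->
  amp s * s `^ (H - 1) = 2 * K * outer_profile delta (p / 2) s.
Proof.
move=> s0; have sne (b c : R) : (b + c == 0) ==> (s != 0).
  by apply/implyP => _; rewrite gt_eqF.
rewrite /amp /outer_profile; case: ifP => _.
  have -> : p / 2 - 1 = - p + (H - 1).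
    by rewrite HE; field; rewrite gt_eqF// (lt_trans _ alpha1).
  by rewrite (powRD (sne (- p) (H - 1))); ring.
have E : - 1 = - p + (- (p / 2) + (H - 1)) :> R.
  by rewrite HE; field; rewrite gt_eqF// (lt_trans _ alpha1).
rewrite [in RHS]E.
by rewrite (powRD (sne (- p) _)) (powRD (sne (- (p / 2)) _)); ring.
Qed.

Lemma far_inner_bound (r : R) : 0 <= r < t ->
  (\int[mu]_r' ((`|r - r'| `^ (2 * H - 2))%:E *
     \int[mu]_z (`|f (r, z)| * `|f (r', z)|)%:E) <=
   (prefactor * outer_profile delta (p / 2) (t - r))%:E)%E.
Proof.
move=> rt; have s0 : 0 < t - r by rewrite subr_gt0; case/andP: rt.
pose c := pi * (amp (t - r) * (2 * K)).
have c0 : 0 <= c.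
  exact: (mulr_ge0 (pi_ge0 R)
    (mulr_ge0 (ltW (amp_gt0 s0)) (mulr_ge0 (ler0n _ 2) (ltW K0)))).
pose g r' : \bar R :=
  (`|(t - r) - (t - r')| `^ (2 * H - 2) * (t - r') `^ (- H))%:E.
have g0 r' : (0 <= g r')%E by rewrite lee_fin mulr_ge0 ?powR_ge0.
have mg (D : set R) : measurable_fun D g.
  apply: measurable_funTS; apply/measurable_EFinP; apply: measurable_funM.
    apply: (measurableT_comp (f := fun u : R => u `^ (2 * H - 2))).
      exact: measurable_powR.
    apply: measurableT_comp => //; apply: measurable_funB => //.
    exact: measurable_funB.
  apply: (measurableT_comp (f := fun u : R => u `^ (- H))).
    exact: measurable_powR.
  exact: measurable_funB.
apply: (@le_trans _ _ (\int[mu]_(r' in `]-oo, t[) (c%:E * g r'))%E).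
  rewrite [leRHS]integral_mkcond; apply: le_integral_of_ge0 => r' _; last first.
    by rewrite patchE; case: ifPn => // _; rewrite mule_ge0// lee_fin.
  rewrite patchE; have [r't|r't] := boolP (0 <= r' < t); last first.
    rewrite [X in (_ * X)%E]integral0_eq ?mule0; last first.
      by move=> z _; rewrite [X in _ * `|X|]far_kernel_out ?normr0 ?mulr0//; exact/negP.
    by case: ifPn => // _; rewrite mule_ge0// lee_fin.
  rewrite ifT; last by rewrite inE/= in_itv/=; case/andP: r't.
  apply: (@le_trans _ _ ((`|r - r'| `^ (2 * H - 2))%:E *
      (pi * (amp (t - r) * amp' (t - r')))%:E)%E).
    by rewrite lee_wpmul2l ?lee_fin ?powR_ge0// far_space_integral.
  rewrite /g -!EFinM lee_fin /c /amp' le_eqVlt; apply/orP; left; apply/eqP.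
  rewrite (_ : t - r - (t - r') = r' - r); last by ring.
  by rewrite distrC; ring.
rewrite ge0_integralZl//; last exact: mg.
apply: (@le_trans _ _ (c%:E * (inner_const H * (t - r) `^ (H - 1))%:E)%E).
  by rewrite lee_wpmul2l ?lee_fin// inner_time_integral.
rewrite -EFinM lee_fin le_eqVlt; apply/orP; left; apply/eqP.
have -> : c * (inner_const H * (t - r) `^ (H - 1)) =
  pi * (2 * K) * inner_const H * (amp (t - r) * (t - r) `^ (H - 1)).
  by rewrite /c; ring.
by rewrite amp_outer// /prefactor; ring.
Qed.

Lemma noise_cov_far_le (T : R) : delta <= T -> t <= T ->
  (noise_cov H (fun u => `|f u|%R) (fun u => `|f u|%R) <=
   (prefactor * (2 * alpha + (ln T - ln delta)))%:E)%E.
Proof.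
move=> dT tT; rewrite /noise_cov.
pose g r : \bar R := (outer_profile delta (p / 2) (t - r))%:E.
have g0 r : (0 <= g r)%E by rewrite lee_fin outer_profile_ge0.
have mg : measurable_fun (`[0%R, t[%classic : set R) g.
  apply: measurable_funTS; apply/measurable_EFinP.
  apply: (measurableT_comp (f := outer_profile delta (p / 2))); last exact: measurable_funB.
  rewrite /outer_profile; apply: measurable_fun_ifT.
  - exact: measurable_fun_ler.
  - by apply: measurable_funM => //; exact: measurable_powR.
  - exact: measurable_powR.
apply: (@le_trans _ _ (\int[mu]_(r in `[0%R, t[) (prefactor%:E * g r))%E).
  rewrite [leRHS]integral_mkcond; apply: le_integral_of_ge0 => r _; last first.
    rewrite patchE; case: ifPn => // rt; rewrite mule_ge0// lee_fin.
  rewrite patchE; case: ifPn => rt.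
    rewrite -EFinM; apply: far_inner_bound.
    by move: rt; rewrite inE/= in_itv/=.
  rewrite integral0_eq// => r' _; rewrite integral0_eq ?mule0// => z _.
  rewrite far_kernel_out ?normr0 ?mul0r//.
  by move=> h1; move/negP: rt; apply; rewrite inE/= in_itv/=.
rewrite ge0_integralZl//.
rewrite (EFinM prefactor) lee_wpmul2l//.
have := @outer_time_integral _ delta (p / 2) t T _ d0 dT tT.
have -> : (p / 2)^-1 = 2 * alpha by field; rewrite gt_eqF// (lt_trans _ alpha1).
by apply; rewrite divr_gt0.
Qed.

End far_kernel.

(** * The main estimate *)

Lemma noise_cov_le_abs (R : realType) (H : R) (f : R * R -> R) :
  (noise_cov H f f <= noise_cov H (fun u => `|f u|%R) (fun u => `|f u|%R))%E.
Proof.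
rewrite /noise_cov.
have inner0 r r' : (0 <= \int[@lebesgue_measure R]_z (`|f (r, z)| * `|f (r', z)|)%:E)%E.
  by apply: integral_ge0 => z _; rewrite lee_fin mulr_ge0.
have mid0 r r' : (0 <= (`|r - r'| `^ (2 * H - 2))%:E *
    \int[@lebesgue_measure R]_z (`|f (r, z)| * `|f (r', z)|)%:E)%E.
  by rewrite mule_ge0 ?lee_fin ?powR_ge0.
apply: le_integral_of_ge0 => r _; last by apply: integral_ge0.
apply: le_integral_of_ge0 => r' _; last exact: mid0.
rewrite lee_wpmul2l ?lee_fin ?powR_ge0//.
apply: le_integral_of_ge0 => z _; rewrite lee_fin ?mulr_ge0//.
by rewrite -normrM ler_norm.
Qed.

Lemma Lnorm2_sqr d (T : measurableType d) (R : realType)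
    (P : probability T R) (X : {RV P >-> R}) :
  ('N[P]_(2%:E)[EFin \o X] ^+ 2 = 'E_P[fun w => (X w * X w)%R])%E.
Proof.
rewrite unlock poweR12_sqrt; last first.
  by apply: integral_ge0 => w _; exact: poweR_ge0.
rewrite sqr_sqrte; last by apply: integral_ge0 => w _; exact: poweR_ge0.
rewrite unlock; apply: eq_integral => w _ /=.
by rewrite powR_mulrn// real_normK ?num_real// expr2.
Qed.

Theorem proposition7p4 (R : realType) (d : measure_display)
    (Omega : measurableType d) (P : probability Omega R)
    (alpha H : R)
    (halpha : 0 < alpha <= 2) (hH : 1 / 2 <= H < 1)
    (halphaH : alpha * H = 3 / 2)
    (W : (R * R -> R) -> {RV P >-> R}) (hW : is_fractional_noise H W)
    (G : R -> R -> R) (hG : is_fundamental_solution alpha G)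
    (t1 t2 : R) (ht1 : 0 < t1) (ht12 : t1 < t2) :
  exists2 K : R, 0 < K &
    forall rho : R, 0 < rho < 1 ->
      exists2 r : R, 0 < r < 1 &
        forall t x h : R, t1 <= t <= t2 -> 0 < h <= r ->
          let delta := window_time alpha rho h in
          let eps := window_space alpha H rho h in
          (('N[P]_(2%:E)
              [EFin \o increment W G (far_set t x delta eps) t x h]) ^+ 2
             <= (K * rho * h ^+ 2 * ln (1 / h))%:E)%E.
Proof.
have /andP[a0 a2] := halpha; have /andP[_ H1] := hH.
have ane : alpha != 0 by rewrite gt_eqF.
have HE : H = 3 / 2 / alpha by rewrite -halphaH mulrAC mulfV ?mul1r.
have H34 : 3 / 4 <= H.
  by rewrite HE ler_pdivlMr//; lra.
have a1 : 1 < alpha.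
  move: H1; rewrite HE ltr_pdivrMr// mul1r; lra.
pose C : R := pi * (34 * expR 1) ^+ 2 * inner_const H.
have C0 : 0 < C.
  by rewrite /C !mulr_gt0 ?pi_gt0 ?inner_const_gt0 ?exprn_gt0 ?mulr_gt0 ?expR_gt0.
pose T := Num.max t2 1.
have T1 : 1 <= T by rewrite le_max lexx orbT.
pose M := 2 * alpha + ln T.
have M0 : 0 < M by rewrite ltr_pwDl ?mulr_gt0// ln_ge0.
(* alpha comes from ln delta = rho alpha ln h, and 1 absorbs the constant M. *)
exists (C * (alpha + 1)); first by rewrite mulr_gt0// addr_gt0.
move=> rho /andP[rho0 rho1].
(* This is the range of h where M <= rho ln (1 / h). *)
exists (expR (- (M / rho))).
  by rewrite expR_gt0/= -expR0 ltr_expR oppr_lt0 divr_gt0.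
move=> t x h /andP[t1t tt2] /andP[h0 hr]; cbv zeta.
set delta := window_time alpha rho h; set eps := window_space alpha H rho h.
set f := increment_kernel G (far_set t x delta eps) t x h.
have lnh : ln h <= - (M / rho).
  by rewrite -ler_expR lnK ?posrE.
have delta0 : 0 < delta by exact: powR_gt0.
have lnd : ln delta = rho * alpha * ln h by exact: ln_powR.
have ln0 : ln h <= 0.
  by rewrite (le_trans lnh)// oppr_le0 divr_ge0// ltW.
have deltaT : delta <= T.
  apply: le_trans T1; rewrite -ler_ln ?posrE// ln1 lnd.
  by rewrite mulr_ge0_le0// mulr_ge0// ltW.
have epsE : eps = delta `^ alpha^-1.
  rewrite /eps window_spaceE// /delta /window_time -powRrM.
  by rewrite mulfK.
have tT : t <= T by rewrite (le_trans tt2)// le_max lexx.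
have := noise_cov_far_le a1 a2 H34 H1 HE hG x h0 delta0 deltaT tT.
rewrite -epsE -/f => covle.
have fint : noise_integrand H f.
  split; last exact: le_lt_trans covle (ltry _).
  apply: (measurable_increment_kernel _ _ _ hG); exact: measurable_far_set.
rewrite Lnorm2_sqr /increment -/f (hW.2 f f fint fint).
apply: (le_trans (noise_cov_le_abs H f)); apply: (le_trans covle).
rewrite lee_fin lnd.
have -> : ln (1 / h) = - ln h by rewrite lnM ?posrE ?invr_gt0// ln1 add0r lnV.
have -> : pi * (2 * (17 * expR 1 * h)) ^+ 2 * inner_const H = C * h ^+ 2.
  by rewrite /C; ring.
rewrite (_ : C * (alpha + 1) * rho * h ^+ 2 * - ln h =
  C * h ^+ 2 * ((alpha + 1) * rho * - ln h)); last by ring.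
apply: ler_wpM2l; first by rewrite mulr_ge0 ?sqr_ge0// ltW.
have Mrho : M <= rho * - ln h.
  rewrite mulrC -ler_pdivrMr//; move: lnh; lra.
rewrite mulrDl mulrDl mul1r.
move: Mrho; rewrite /M; lra.
Qed.
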